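(* Let $b\ge 1$. For every $\alpha>0$ the final value problem $$\frac{\partial^\gamma v_\alpha}{\partial t^\gamma}+A_\alpha v_\alpha=0,\quad 0<t<T,\qquad v_\alpha(T)=f, \qquad (\mathrm P_\alpha)$$ is well-posed: for every $f\in\mathbb H$ it has a unique solution $v_\alpha$, and this solution depends continuously on $f$. Moreover, for every $p>0$ there exist constants $C_1$ (if $p<b$) and $C_2$ (if $p\ge b$), depending only on $\gamma,T,\lambda_1,p,b$, such that the following holds. Let $0<\varepsilon<E$, let $f\in\mathbb H$, and let $u$ be a solution of the backward problem $$\frac{\partial^\gamma u}{\partial t^\gamma}+Au=0,\quad 0<t<T,\qquad \|u(T)-f\|\le\varepsilon,$$ with $u(0)\in D(A^p)$ and $\|u(0)\|_p\le E$. Let $v_\alpha$ be the solution of $(\mathrm P_\alpha)$ with this $f$. (i) If $0<p<b$, then with $\alpha=\left(\frac{\varepsilon}{E}\right)^{\frac{b}{p+1}}$, $$\|u(0)-v_\alpha(0)\|\le C_1\,\varepsilon^{\frac{p}{p+1}}E^{\frac{1}{p+1}}.$$ (ii) If $p\ge b$, then with $\alpha=\left(\frac{\varepsilon}{E}\right)^{\frac{b}{b+1}}$, $$\|u(0)-v_\alpha(0)\|\le C_2\,\varepsilon^{\frac{b}{b+1}}E^{\frac{1}{b+1}}.$$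
   Context: Fix $\gamma\in(0,1)$ and $T>0$. $\mathbb H$ is a Hilbert space with inner product $\langle\cdot,\cdot\rangle$ and norm $\|\cdot\|$. $A:D(A)\subset\mathbb H\to\mathbb H$ is a self-adjoint closed operator such that $-A$ generates a compact contraction semigroup on $\mathbb H$, and $A$ admits an orthonormal eigenbasis $\{\phi_n\}_{n\ge1}$ of $\mathbb H$ with $A\phi_n=\lambda_n\phi_n$, $0<\lambda_1<\lambda_2<\cdots$, $\lambda_n\to+\infty$. For $p>0$, $D(A^p)=\{\psi\in\mathbb H:\sum_{n\ge1}\lambda_n^{2p}|\langle\psi,\phi_n\rangle|^2<\infty\}$ and $\|\psi\|_p=\left(\sum_{n\ge1}\lambda_n^{2p}|\langle\psi,\phi_n\rangle|^2\right)^{1/2}$. The Caputo derivative is $\frac{\partial^\gamma u}{\partial t^\gamma}(t)=\frac{1}{\Gamma(1-\gamma)}\int_0^t(t-s)^{-\gamma}\frac{\partial u}{\partial s}(s)\,ds$. For $b\ge1$ and $\alpha>0$, $A^bv=\sum_{n\ge1}\lambda_n^b\langle v,\phi_n\rangle\phi_n$ for $v \in D(A^b)$, and $A_\alpha=(I+\alpha A^b)^{-1}A$, i.e. $A_\alpha v=\sum_{n\ge1}\frac{\lambda_n}{1+\alpha\lambda_n^b}\langle v,\phi_n\rangle\phi_n$ (a bounded operator on $\mathbb H$). A solution of $\partial^\gamma u/\partial t^\gamma+Lu=0$, $0<t<T$ (with $L=A$ or $L=A_\alpha$) is a function $u\in C^1((0,T),\mathbb H)\cap C([0,T],\mathbb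 H)$ with $u(t)\in D(L)$ for all $t\in(0,T)$ satisfying the equation on $(0,T)$; solutions of the problems in the claim additionally satisfy the stated condition at $t=T$. Continuous dependence on $f$ is from $\mathbb H$ to $C([0,T],\mathbb H)$ with the sup norm. *)

(* Defs.v *)
(* Stdlib reals + Coquelicot *)
From Stdlib Require Export Reals.
From Coquelicot Require Export Coquelicot.
Open Scope R_scope.

Set Implicit Arguments.
Unset Strict Implicit.

Inductive scalar_kind := RealScalars | ComplexScalars.

Definition scalar (k : scalar_kind) : AbsRing :=
  match k with RealScalars => R_AbsRing | ComplexScalars => C_AbsRing end.

Definition conj (k : scalar_kind) : scalar k -> scalar k :=
  match k return scalar k -> scalar k with
  | RealScalars => fun x => x
  | ComplexScalars => Cconj
  end.

Definition ofR (k : scalar_kind) : R -> scalar k :=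
  match k return R -> scalar k with
  | RealScalars => fun x => x
  | ComplexScalars => RtoC
  end.

(* A Hilbert space over R or C.  The underlying complete normed module is over
   R in both cases, because derivatives and integrals with respect to the real
   variable t need a real structure; [smul] is the multiplication by scalars of
   the field and extends the real one. *)
Record HilbertSpace (k : scalar_kind) := {
  hspace :> CompleteNormedModule R_AbsRing;
  smul : scalar k -> hspace -> hspace;
  inner : hspace -> hspace -> scalar k;
  smul_ofR : forall (r : R) (x : hspace), smul (ofR k r) x = scal r x;
  smul_assoc : forall (a c : scalar k) (x : hspace),
    smul a (smul c x) = smul (mult a c) x;
  smul_distr_l : forall (a : scalar k) (x y : hspace),
    smul a (plus x y) = plus (smul a x) (smul a y);
  smul_distr_r : forall (a c : scalar k) (x : hspace),
    smul (plus a c) x = plus (smul a x) (smul c x);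
  inner_plus_l : forall x y z : hspace,
    inner (plus x y) z = plus (inner x z) (inner y z);
  inner_smul_l : forall (a : scalar k) (x y : hspace),
    inner (smul a x) y = mult a (inner x y);
  inner_conj : forall x y : hspace, inner y x = conj (inner x y);
  inner_norm : forall x : hspace, inner x x = ofR k (norm x ^ 2)
}.

(* The values of [op] outside [dom] are irrelevant. *)
Record operator k (H : HilbertSpace k) := {
  dom : H -> Prop;
  op :> H -> H
}.

Section Operators.

Variables (k : scalar_kind) (H : HilbertSpace k).
Implicit Types (A L : operator H) (S : R -> H -> H).

Definition linear_operator A : Prop :=
  dom A zero /\
  (forall x y : H, dom A x -> dom A y ->
     dom A (plus x y) /\ A (plus x y) = plus (A x) (A y)) /\
  (forall (a : scalar k) (x : H), dom A x ->
     dom A (smul a x) /\ A (smul a x) = smul a (A x)).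

Definition densely_defined A : Prop :=
  forall (x : H) (eps : R), 0 < eps ->
    exists y : H, dom A y /\ norm (minus y x) < eps.

Definition in_adjoint A (y z : H) : Prop :=
  forall x : H, dom A x -> inner (A x) y = inner x z.

Definition self_adjoint A : Prop :=
  densely_defined A /\
  forall y z : H, (dom A y /\ A y = z) <-> in_adjoint A y z.

Definition closed_operator A : Prop :=
  forall (x : nat -> H) (y z : H), (forall n, dom A (x n)) ->
    filterlim x eventually (locally y) ->
    filterlim (fun n => A (x n)) eventually (locally z) ->
    dom A y /\ A y = z.

Definition opp_operator A : operator H :=
  {| dom := dom A; op := fun x => opp (A x) |}.

Definition contraction_semigroup S : Prop :=
  (forall t, 0 <= t ->
     (forall x y : H, S t (plus x y) = plus (S t x) (S t y)) /\
     (forall (a : scalar k) (x : H), S t (smul a x) = smul a (S t x)) /\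
     (forall x : H, norm (S t x) <= norm x)) /\
  (forall x : H, S 0 x = x) /\
  (forall s t (x : H), 0 <= s -> 0 <= t -> S (s + t) x = S s (S t x)) /\
  (forall x : H, filterlim (fun t => S t x) (at_right 0) (locally x)).

Definition compact_map (K : H -> H) : Prop :=
  forall x : nat -> H, (exists M : R, forall n, norm (x n) <= M) ->
    exists (sigma : nat -> nat) (y : H),
      (forall n, (sigma n < sigma (S n))%nat) /\
      filterlim (fun n => K (x (sigma n))) eventually (locally y).

Definition generates L S : Prop :=
  forall x y : H, (dom L x /\ L x = y) <->
    filterlim (fun t => scal (/ t) (minus (S t x) x)) (at_right 0) (locally y).

Definition generates_compact_contraction_semigroup L : Prop :=
  exists S : R -> H -> H,
    contraction_semigroup S /\
    (forall t, 0 < t -> compact_map (S t)) /\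
    generates L S.

Definition orthonormal_basis (phi : nat -> H) : Prop :=
  (forall n, inner (phi n) (phi n) = one) /\
  (forall m n, m <> n -> inner (phi m) (phi n) = zero) /\
  (forall v : H, is_series (fun n => smul (inner v (phi n)) (phi n)) v).

(* Indices start at 0: [phi n] and [lambda n] stand for phi_{n+1} and
   lambda_{n+1}. *)
Definition admissible A (phi : nat -> H) (lambda : nat -> R) : Prop :=
  linear_operator A /\
  self_adjoint A /\
  closed_operator A /\
  generates_compact_contraction_semigroup (opp_operator A) /\
  orthonormal_basis phi /\
  (forall n, dom A (phi n) /\ A (phi n) = scal (lambda n) (phi n)) /\
  0 < lambda O /\
  (forall n, lambda n < lambda (S n)) /\
  is_lim_seq lambda p_infty.

Section Spectral.

Variables (phi : nat -> H) (lambda : nat -> R).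

Definition pow_terms (p : R) (v : H) (n : nat) : R :=
  Rpower (lambda n) (2 * p) * abs (inner v (phi n)) ^ 2.

Definition dom_pow (p : R) (v : H) : Prop := ex_series (pow_terms p v).

Definition norm_pow (p : R) (v : H) : R := sqrt (Series (pow_terms p v)).

(* [iota (is_series a)] is the sum of [a]; the series below converges for every
   v when b >= 1 and alpha > 0, since its multipliers are then bounded. *)
Definition A_alpha (b alpha : R) : operator H := {|
  dom := fun _ => True;
  op := fun v => iota (is_series (fun n =>
    scal (lambda n / (1 + alpha * Rpower (lambda n) b))
         (smul (inner v (phi n)) (phi n))))
|}.

End Spectral.

Definition Gamma (x : R) : R :=
  RInt_gen (fun s => Rpower s (x - 1) * exp (- s))
           (at_right 0) (Rbar_locally p_infty).

(* [is_caputo gamma du t w]: w is the Caputo derivative of order gamma at t of a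
   function with derivative [du].  The integral is an improper H-valued integral
   at both ends: the kernel is singular at s = t, and [du] may be unbounded near
   s = 0.  It converges for every function in C^1((0,T),H) that is continuous
   on [0,T]. *)
Definition is_caputo (gamma : R) (du : R -> H) (t : R) (w : H) : Prop :=
  exists I : H,
    is_RInt_gen (fun s => scal (Rpower (t - s) (- gamma)) (du s))
                (at_right 0) (at_left t) I /\
    w = scal (/ Gamma (1 - gamma)) I.

Definition is_solution (gamma T : R) L (u : R -> H) : Prop :=
  continuous_on (fun t => 0 <= t <= T) u /\
  exists du : R -> H,
    (forall t, 0 < t < T -> is_derive u t (du t) /\ continuous du t) /\
    (forall t, 0 < t < T -> dom L (u t) /\
       exists w : H, is_caputo gamma du t w /\ plus w (L (u t)) = zero).

Definition is_final_value_solution (gamma T : R) L (f : H) (u : R -> H) : Prop :=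
  is_solution gamma T L u /\ u T = f.

(* Functions are total on R, so uniqueness is equality on [0,T]. *)
Definition well_posed (gamma T : R) L : Prop :=
  (forall f : H,
     (exists v : R -> H, is_final_value_solution gamma T L f v) /\
     (forall v w : R -> H,
        is_final_value_solution gamma T L f v ->
        is_final_value_solution gamma T L f w ->
        forall t, 0 <= t <= T -> v t = w t)) /\
  (forall (f : H) (eps : R), 0 < eps ->
     exists delta : R, 0 < delta /\
       forall (g : H) (v w : R -> H), norm (minus g f) < delta ->
         is_final_value_solution gamma T L f v ->
         is_final_value_solution gamma T L g w ->
         forall t, 0 <= t <= T -> norm (minus (w t) (v t)) <= eps).

Definition backward_solution (gamma T : R) A (phi : nat -> H)
    (lambda : nat -> R) (p eps E : R) (f : H) (u : R -> H) : Prop :=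
  is_solution gamma T A u /\
  norm (minus (u T) f) <= eps /\
  dom_pow phi lambda p (u 0) /\
  norm_pow phi lambda p (u 0) <= E.

End Operators.

(* Main.v *)
Require Import Defs.
From Stdlib Require Import Reals Lra Psatz Lia.
From Coquelicot Require Import Coquelicot.
Open Scope R_scope.

(** Expanding in the eigenbasis reduces everything to the scalar equation
    [D^g y = - mu y], whose solution is [y 0 * E_g(- mu t^g)].  The Mittag-Leffler
    series is shown to solve it by computing the coefficients from Beta integrals;
    everything else follows from a maximum principle: at a maximum [t] of [z] over
    [0, t], the Caputo derivative of [z] is at least
    [t^(-g) (z t - z 0) / Gamma (1 - g)].  It yields uniqueness, positivity and
    monotonicity of [x |-> E_g(- x)], the bounds
    [1 / (1 + Gamma (1 - g) x) <= E_g(- x)] and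
    [Gamma (1 - g) x E_g(- x) <= K := 2 / (1 - g)], and
    [E_g(- x) <= (1 + K th) E_g(- (1 + th) x)].

    With [tau = T^g], [th_n = alpha lambda_n^b] and [mu_n = lambda_n / (1 + th_n)],
    the [n]-th coordinate of [u 0 - v 0] is [(1 - r_n) u_n(0) + (u_n(T) - f_n) / E_g(- mu_n tau)]
    with [r_n = E_g(- lambda_n tau) / E_g(- mu_n tau)].  The last bound, at
    [x = mu_n tau], gives [0 <= 1 - r_n <= min (1, K th_n)], which controls the first term
    by the source condition; the second one is controlled by the lower bound
    and [mu_n <= alpha^(- 1 / b)]. *)

(** The equation for [A_alpha] has to be solved in [H], with integrals improper at both ends: the
    kernel is singular at [s = t], and the derivative of a solution behaves like s^(g - 1) near 0.
    Convergence of each coordinate would not give convergence in norm, so the truncation estimates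
    are uniform: the bound [gap a b] on the tails of the Beta integrals is the same for all [k],
    hence the truncated Caputo integrals of E_g(- mu t^g) converge uniformly for |mu| <= M, and
    Parseval sums the errors. The constant K comes from adding the linear function 2 s to E_g(- x
    s^g): the slope 2 forces the maximum away from 0, and the fractional derivative of 2 s
    contributes at most 2 / (1 - g). With q = min (p, b), the two error terms are of size
    alpha^(q/b) E and alpha^(- 1/b) eps, and alpha = (eps/E)^(b/(q+1)) makes them equal. The rate
    saturates at p = b because the bound K th_n is of first order; beyond it the surplus lambda_n^(b
    - p) is merely bounded by lambda_1^(b - p), which brings lambda_1 into C_2. *)

Lemma is_RInt_gen_oo {V : NormedModule R_AbsRing} (f : R -> V) (c d : R) (l : V) :
  is_RInt_gen f (at_right c) (at_left d) l <->
  forall eps, 0 < eps -> exists delta, 0 < delta /\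
    forall a b, c < a < c + delta -> d - delta < b < d ->
      exists y, is_RInt f a b y /\ norm (minus y l) < eps.
Proof.
split.
- intros H eps Heps.
  assert (Hb : locally l (fun y => norm (minus y l) < eps)).
  { exact (locally_ball_norm l (mkposreal _ Heps)). }
  destruct (H _ Hb) as [Q R0 HQ HR Hf].
  destruct HQ as [d1 Hd1]; destruct HR as [d2 Hd2].
  exists (Rmin d1 d2); split.
  { apply Rmin_pos; [apply d1 | apply d2]. }
  intros a b Ha Hb'.
  pose proof (Rmin_l d1 d2); pose proof (Rmin_r d1 d2).
  apply (Hf a b).
  + apply Hd1; [|lra].
    apply Rabs_def1; unfold minus, plus, opp; simpl; lra.
  + apply Hd2; [|lra].
    apply Rabs_def1; unfold minus, plus, opp; simpl; lra.
- intros H P HP.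
  apply locally_norm_le_locally in HP.
  destruct HP as [eps Heps].
  destruct (H eps (cond_pos eps)) as [delta [Hd Hdd]].
  exists (fun a => c < a < c + delta) (fun b => d - delta < b < d).
  + exists (mkposreal _ Hd); intros y Hy Hcy.
    apply Rabs_def2 in Hy; unfold minus, plus, opp in Hy; simpl in Hy; lra.
  + exists (mkposreal _ Hd); intros y Hy Hcy.
    apply Rabs_def2 in Hy; unfold minus, plus, opp in Hy; simpl in Hy; lra.
  + intros a b Ha Hb; destruct (Hdd a b Ha Hb) as [y [Hy Hn]].
    exists y; split; [exact Hy | apply Heps; exact Hn].
Qed.

(** Enlarging the interval only increases the integral, so the improper integral is the supremum of
    the truncated ones. The right end and its filter are left general in order to cover both the
    Gamma integral (at infinity) and the Beta integrals (at 1). *)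
Lemma ex_RInt_gen_nonneg (f : R -> R) (c : R) (d : Rbar)
    (Fb : (R -> Prop) -> Prop) {FFb : ProperFilter Fb} (M : R) :
  Rbar_lt c d ->
  (forall b : R, Rbar_lt b d -> Fb (fun x => b < x /\ Rbar_lt x d)) ->
  (forall x, c < x -> Rbar_lt x d -> continuous f x) ->
  (forall x, c < x -> Rbar_lt x d -> 0 <= f x) ->
  (forall a b, c < a -> a <= b -> Rbar_lt b d -> RInt f a b <= M) ->
  exists l, is_RInt_gen f (at_right c) Fb l /\
    forall a b, c < a -> a <= b -> Rbar_lt b d -> RInt f a b <= l.
Proof.
intros Hcd HFb Hcont Hpos HM.
assert (Hex : forall a b, c < a -> a <= b -> Rbar_lt b d -> ex_RInt f a b).
{ intros a b Ha Hab Hb. apply (ex_RInt_continuous f).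
  intros z Hz. rewrite Rmin_left in Hz by lra. rewrite Rmax_right in Hz by lra.
  apply Hcont; [lra|]. apply Rbar_le_lt_trans with (y := Finite b); [simpl; lra | exact Hb]. }
assert (Hge : forall a b, c < a -> a <= b -> Rbar_lt b d -> 0 <= RInt f a b).
{ intros a b Ha Hab Hb. apply RInt_ge_0; [lra | auto |].
  intros x Hx. apply Hpos; [lra|].
  apply Rbar_le_lt_trans with (y := Finite b); [simpl; lra | exact Hb]. }
set (S := fun y => exists a b, c < a /\ a <= b /\ Rbar_lt b d /\ y = RInt f a b).
assert (Hmid : exists m, c < m /\ Rbar_lt m d).
{ destruct d as [d| |]; simpl in *.
  - exists ((c + d) / 2); lra.
  - exists (c + 1); split; [lra | exact I].
  - contradiction. }
destruct Hmid as [m [Hm1 Hm2]].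
destruct (completeness S) as [l [Hub Hlub]].
{ exists M. intros y (a & b & Ha & Hab & Hb & ->). auto. }
{ exists (RInt f m m). exists m, m. repeat split; auto; lra. }
exists l. split.
2:{ intros a b Ha Hab Hb. apply Hub. exists a, b. auto. }
apply filterlimi_locally. intros eps.
assert (Hx : exists a b, c < a /\ a <= b /\ Rbar_lt b d /\ l - eps < RInt f a b).
{ apply Classical_Prop.NNPP. intros Hn.
  assert (l <= l - eps).
  { apply Hlub. intros y (a & b & Ha & Hab & Hb & ->).
    apply Rnot_lt_le. intros Hlt. apply Hn. exists a, b. auto. }
  pose proof (cond_pos eps). lra. }
destruct Hx as (a & b & Ha & Hab & Hb & Hlt).
exists (fun x => c < x < a) (fun x => b < x /\ Rbar_lt x d).
- assert (Hd : 0 < a - c) by lra.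
  exists (mkposreal _ Hd). intros y Hy Hcy.
  apply Rabs_def2 in Hy; unfold minus, plus, opp in Hy; simpl in Hy; lra.
- auto.
- assert (Had : Rbar_lt a d) by exact (Rbar_le_lt_trans (Finite a) (Finite b) d Hab Hb).
  intros a' b' Ha' [Hb' Hb'd]. exists (RInt f a' b'). simpl.
  split. { apply (RInt_correct f). apply Hex; auto; lra. }
  assert (Hle : RInt f a' b' <= l).
  { apply Hub. exists a', b'. repeat split; auto; lra. }
  assert (RInt f a b <= RInt f a' b').
  { rewrite <- (RInt_Chasles f a' a b') by (apply Hex; auto; try lra).
    rewrite <- (RInt_Chasles f a b b') by (apply Hex; auto; try lra).
    unfold plus; simpl.
    pose proof (Hge a' a ltac:(lra) ltac:(lra) Had).
    pose proof (Hge b b' ltac:(lra) ltac:(lra) Hb'd). lra. }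
  apply Rabs_def1; unfold minus, plus, opp; simpl; lra.
Qed.

(** * Powers and the Gamma function *)

Lemma Rpower_pos (x y : R) : 0 < Rpower x y.
Proof. apply exp_pos. Qed.

Lemma is_derive_Rpower (x y : R) : 0 < x ->
  is_derive (fun s => Rpower s y) x (y * Rpower x (y - 1)).
Proof. intros Hx. apply is_derive_Reals. now apply derivable_pt_lim_power. Qed.

Lemma continuous_Rpower (x y : R) : 0 < x -> continuous (fun s => Rpower s y) x.
Proof.
intros Hx. apply (ex_derive_continuous (fun s => Rpower s y)).
eexists. now apply is_derive_Rpower.
Qed.

Lemma Rpower_le_base (x z y : R) : 0 < x <= z -> 0 <= y -> Rpower x y <= Rpower z y.
Proof. intros Hx Hy. apply Rle_Rpower_l; lra. Qed.

Lemma Rpower_le_base_neg (x z y : R) : 0 < x <= z -> y <= 0 -> Rpower z y <= Rpower x y.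
Proof.
intros Hx Hy. replace y with (- - y) by ring. rewrite (Rpower_Ropp z), (Rpower_Ropp x).
apply Rinv_le_contravar; [apply Rpower_pos | apply Rpower_le_base; lra].
Qed.

Lemma Rpower_le_1 (x y : R) : 0 < x <= 1 -> 0 <= y -> Rpower x y <= 1.
Proof. intros Hx Hy. replace 1 with (Rpower 1 y); [now apply Rpower_le_base|].
unfold Rpower. now rewrite ln_1, Rmult_0_r, exp_0. Qed.

Lemma Rpower_small (y eps : R) : 0 < y -> 0 < eps ->
  exists delta, 0 < delta /\ forall x, 0 < x < delta -> Rpower x y < eps.
Proof.
intros Hy He. exists (Rpower eps (/ y)). split; [apply Rpower_pos|].
intros x Hx. replace eps with (Rpower (Rpower eps (/ y)) y).
- apply exp_increasing, Rmult_lt_compat_l; [lra|]. now apply ln_increasing.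
- rewrite Rpower_mult, Rinv_l by lra. now apply Rpower_1.
Qed.

Lemma ex_RInt_continuous_on {V : CompleteNormedModule R_AbsRing} (f : R -> V) (a b : R) :
  a <= b -> (forall x, a <= x <= b -> continuous f x) -> ex_RInt f a b.
Proof.
intros Hab Hf. apply ex_RInt_continuous. intros z.
rewrite Rmin_left, Rmax_right by lra. apply Hf.
Qed.

Lemma is_RInt_derive_on (f df : R -> R) (a b : R) : a <= b ->
  (forall x, a <= x <= b -> is_derive f x (df x)) ->
  (forall x, a <= x <= b -> continuous df x) -> is_RInt df a b (f b - f a).
Proof.
intros Hab H1 H2. apply (is_RInt_derive f df); rewrite Rmin_left, Rmax_right by lra; auto.
Qed.

Lemma continuous_Rmult (f h : R -> R) (x : R) :
  continuous f x -> continuous h x -> continuous (fun s => f s * h s) x.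
Proof. intros; now apply (continuous_mult f h). Qed.

Lemma continuous_Rplus (f h : R -> R) (x : R) :
  continuous f x -> continuous h x -> continuous (fun s => f s + h s) x.
Proof. intros; now apply (continuous_plus f h). Qed.

Lemma continuous_reflect {V : UniformSpace} (f : R -> V) (t s : R) :
  continuous f (t - s) -> continuous (fun r => f (t - r)) s.
Proof.
intros H. apply (continuous_comp (fun r => t - r) f); [|exact H].
apply (continuous_minus (fun _ => t) (fun r => r)); [apply continuous_const | apply continuous_id].
Qed.

(** [Gamma] is defined by [RInt_gen], whose value means nothing before convergence is known; so the
    truncated integrals are first bounded, and then the limit is compared with the integral over
    [1, 2]. *)
Lemma Gamma_pos (x : R) : 0 < x < 1 -> 0 < Gamma x.
Proof.
intros Hx. set (f := fun s => Rpower s (x - 1) * exp (- s)).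
assert (Hcont : forall s, 0 < s -> continuous f s).
{ intros s Hs. apply continuous_Rmult; [now apply continuous_Rpower|].
  apply (ex_derive_continuous (fun s => exp (- s))). auto_derive. exact I. }
assert (Hpos : forall s, 0 < f s).
{ intros s. apply Rmult_lt_0_compat; [apply Rpower_pos | apply exp_pos]. }
(* [s ^ x * exp (- s) / x] is what integration by parts suggests; the correction
   [- (2 + s) * exp (- s) / x] has derivative [(1 + s) * exp (- s) / x], which absorbs the leftover
   because [s ^ x <= 1 + s]. Thus [dG >= f], and [G] stays between - 2 / x and 0. *)
set (G := fun s => (Rpower s x - (2 + s)) * exp (- s) / x).
set (dG := fun s => f s + (1 + s - Rpower s x) * exp (- s) / x).
assert (Hsx : forall s, 0 < s -> Rpower s x <= 1 + s).
{ intros s Hs. destruct (Rle_dec s 1).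
  - pose proof (Rpower_le_1 s x). lra.
  - assert (Rpower s x <= Rpower s 1) by (apply Rle_Rpower; lra).
    rewrite Rpower_1 in H by lra. lra. }
assert (HG : forall s, 0 < s -> is_derive G s (dG s)).
{ intros s Hs. unfold G.
  auto_derive.
  - exists (x * Rpower s (x - 1)). now apply is_derive_Rpower.
  - replace (Derive (fun s : R => Rpower s x) s) with (x * Rpower s (x - 1)).
    2:{ symmetry. apply is_derive_unique. now apply is_derive_Rpower. }
    unfold dG, f. field. lra. }
assert (HdG : forall s, 0 < s -> continuous dG s).
{ intros s Hs. apply (continuous_Rplus f); [auto|].
  apply (ex_derive_continuous (fun s => (1 + s - Rpower s x) * exp (- s) / x)).
  auto_derive. exists (x * Rpower s (x - 1)). now apply is_derive_Rpower. }
destruct (ex_RInt_gen_nonneg f 0 p_infty (Rbar_locally p_infty) (2 / x)) as [l [Hl Hl2]].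
- exact I.
- intros b _. exists b. intros y Hy. split; [exact Hy | exact I].
- auto.
- intros s _ _. apply Rlt_le, Hpos.
- intros a b Ha Hab _.
  assert (Hb2 : is_RInt dG a b (G b - G a)).
  { apply is_RInt_derive_on; [exact Hab | |]; intros s Hs; [apply HG | apply HdG]; lra. }
  assert (RInt f a b <= G b - G a).
  { apply (is_RInt_le f dG a b); [exact Hab | | exact Hb2 |].
    - apply (RInt_correct f). apply ex_RInt_continuous_on; [exact Hab|]. intros s Hs.
      apply Hcont; lra.
    - intros s Hs. unfold dG. assert (0 <= (1 + s - Rpower s x) * exp (- s) / x); [|lra].
      apply Rmult_le_pos; [|left; apply Rinv_0_lt_compat; lra].
      apply Rmult_le_pos; [pose proof (Hsx s); lra | left; apply exp_pos]. }
  assert (G b <= 0).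
  { unfold G. assert (0 <= (2 + b - Rpower b x) * exp (- b) / x); [|unfold Rdiv in *; lra].
    apply Rmult_le_pos; [|left; apply Rinv_0_lt_compat; lra].
    apply Rmult_le_pos; [pose proof (Hsx b); lra | left; apply exp_pos]. }
  assert (- (2 / x) <= G a).
  { unfold G.
    assert (0 <= (2 - (2 + a) * exp (- a) + Rpower a x * exp (- a)) / x); [|unfold Rdiv in *; lra].
    apply Rmult_le_pos; [|left; apply Rinv_0_lt_compat; lra].
    assert (0 <= Rpower a x * exp (- a)) by (apply Rmult_le_pos; left; apply exp_pos).
    assert ((2 + a) * exp (- a) <= 2); [|lra].
    rewrite exp_Ropp. pose proof (exp_ineq1_le a). apply (Rmult_le_reg_r (exp a)); [apply exp_pos|].
    rewrite Rmult_assoc, Rinv_l by (apply Rgt_not_eq, exp_pos). lra. }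
  lra.
- unfold Gamma. fold f. rewrite (is_RInt_gen_unique f l Hl).
  apply Rlt_le_trans with (RInt f 1 2).
  + apply RInt_gt_0; [lra | auto |]. intros s Hs. apply Hcont; lra.
  + apply Hl2; [lra | lra | exact I].
Qed.

Section FractionalExponential.

Variable g : R.
Hypothesis Hg : 0 < g < 1.

(** * Beta integrals with tails bounded uniformly in the index *)

Definition beta_kernel (k : nat) (s : R) : R :=
  Rpower (1 - s) (- g) * Rpower s (g * INR (S k) - 1).

(** Euler's B(1 - g, g (k + 1)): up to the factor g (k + 1), the Caputo integral at time 1 of the
    monomial s^(g (k + 1)). *)
Definition beta (k : nat) : R := RInt_gen (beta_kernel k) (at_right 0) (at_left 1).

(* [s ^ (g - 1) (1 - s) ^ (- g) <= 2 s ^ (g - 1) + 2 (1 - s) ^ (- g)], and the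
   right-hand side has the primitive [majorant], which increases from
   [- 2 / (1 - g)] to [2 / g] on [0, 1]. *)
Definition majorant (s : R) : R :=
  2 * Rpower s g / g - 2 * Rpower (1 - s) (1 - g) / (1 - g).

(** The integral of the derivative of [majorant] over the part of (0, 1) outside [a, b]. It does not
    involve [k]. *)
Definition gap (a b : R) : R := 2 / g + 2 / (1 - g) - (majorant b - majorant a).

Lemma exponent_ge (k : nat) : g <= g * INR (S k).
Proof. rewrite S_INR. pose proof (pos_INR k). nra. Qed.

Lemma beta_kernel_pos (k : nat) (s : R) : 0 < beta_kernel k s.
Proof. apply Rmult_lt_0_compat; apply Rpower_pos. Qed.

Lemma continuous_beta_kernel (k : nat) (s : R) : 0 < s < 1 -> continuous (beta_kernel k) s.
Proof.
intros Hs. apply continuous_Rmult.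
- apply (continuous_reflect (fun r => Rpower r (- g))). apply continuous_Rpower; lra.
- apply continuous_Rpower; lra.
Qed.

Lemma beta_kernel_le_0 (k : nat) (s : R) : 0 < s < 1 -> beta_kernel k s <= beta_kernel 0 s.
Proof.
intros Hs. apply Rmult_le_compat_l; [left; apply Rpower_pos|].
replace (g * INR 1) with g by (simpl; ring).
apply Ropp_le_cancel.
assert (H : Rpower s (g * INR (S k) - 1) = Rpower s (g * INR (S k) - g) * Rpower s (g - 1)).
{ rewrite <- Rpower_plus. f_equal. ring. }
rewrite H. pose proof (Rpower_pos s (g - 1)).
pose proof (exponent_ge k).
pose proof (Rpower_le_1 s (g * INR (S k) - g) ltac:(lra) ltac:(lra)). nra.
Qed.

Lemma half_power (s y : R) : / 2 <= s -> -1 <= y <= 0 -> Rpower s y <= 2.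
Proof.
intros Hs Hy. apply Rle_trans with (Rpower (/ 2) y).
- apply Rpower_le_base_neg; lra.
- rewrite <- (Rpower_1 2) at 2 by lra.
  unfold Rpower. rewrite ln_Rinv by lra.
  destruct (Req_dec y (-1)) as [->|Hn]; [right; f_equal; ring|].
  left. apply exp_increasing. pose proof ln_lt_2. nra.
Qed.

Definition dmajorant (s : R) : R := 2 * Rpower s (g - 1) + 2 * Rpower (1 - s) (- g).

Lemma is_derive_majorant (s : R) : 0 < s < 1 -> is_derive majorant s (dmajorant s).
Proof.
intros Hs. unfold majorant, dmajorant.
assert (H1 : is_derive (fun r => Rpower r g) s (g * Rpower s (g - 1)))
  by (apply is_derive_Rpower; lra).
assert (H2 : is_derive (fun r => Rpower r (1 - g)) (1 - s) ((1 - g) * Rpower (1 - s) (1 - g - 1)))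
  by (apply is_derive_Rpower; lra).
auto_derive.
- split; [eexists; exact H1 | split; [|exact I]]. eexists; exact H2.
- replace (Derive (fun r : R => Rpower r g) s) with (g * Rpower s (g - 1))
    by (symmetry; apply is_derive_unique; exact H1).
  replace (Derive (fun r : R => Rpower r (1 - g)) (1 + - s))
    with ((1 - g) * Rpower (1 - s) (1 - g - 1))
    by (symmetry; apply is_derive_unique; exact H2).
  replace (1 - g - 1) with (- g) by ring. field. lra.
Qed.

Lemma is_RInt_dmajorant (a b : R) : 0 < a <= b -> b < 1 ->
  is_RInt dmajorant a b (majorant b - majorant a).
Proof.
intros Ha Hb. apply is_RInt_derive_on; [lra | |].
- intros s Hs. apply is_derive_majorant; lra.
- intros s Hs. apply continuous_Rplus; apply continuous_Rmult; try apply continuous_const.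
  + apply continuous_Rpower; lra.
  + apply (continuous_reflect (fun r => Rpower r (- g))). apply continuous_Rpower; lra.
Qed.

(** On each half of (0, 1) one of the two factors of [beta_kernel 0] is away from its singularity
    and at most 2; the other factor appears in [dmajorant]. *)
Lemma beta_kernel_le (k : nat) (s : R) : 0 < s < 1 -> beta_kernel k s <= dmajorant s.
Proof.
intros Hs. apply Rle_trans with (1 := beta_kernel_le_0 k s Hs).
unfold beta_kernel, dmajorant. replace (g * INR 1) with g by (simpl; ring).
pose proof (Rpower_pos s (g - 1)). pose proof (Rpower_pos (1 - s) (- g)).
destruct (Rle_dec (/ 2) s).
- pose proof (half_power s (g - 1)). nra.
- pose proof (half_power (1 - s) (- g)). nra.
Qed.

Lemma is_RInt_beta_kernel (k : nat) (a b : R) : 0 < a <= b -> b < 1 ->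
  is_RInt (beta_kernel k) a b (RInt (beta_kernel k) a b).
Proof.
intros Ha Hb. apply (RInt_correct (beta_kernel k)), ex_RInt_continuous_on; [lra|].
intros s Hs. apply continuous_beta_kernel; lra.
Qed.

Lemma RInt_beta_kernel_le (k : nat) (a b : R) : 0 < a <= b -> b < 1 ->
  RInt (beta_kernel k) a b <= majorant b - majorant a.
Proof.
intros Ha Hb. apply (is_RInt_le (beta_kernel k) dmajorant a b); [lra | | |].
- now apply is_RInt_beta_kernel.
- now apply is_RInt_dmajorant.
- intros s Hs. apply beta_kernel_le; lra.
Qed.

Lemma majorant_lower (a : R) : 0 < a < 1 -> - (2 / (1 - g)) <= majorant a.
Proof.
intros Ha. unfold majorant.
assert (0 <= 2 * Rpower a g / g).
{ apply Rmult_le_pos; [pose proof (Rpower_pos a g); lra | left; apply Rinv_0_lt_compat; lra]. }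
assert (2 * Rpower (1 - a) (1 - g) / (1 - g) <= 2 / (1 - g)); [|lra].
apply Rmult_le_compat_r; [left; apply Rinv_0_lt_compat; lra|].
pose proof (Rpower_le_1 (1 - a) (1 - g)). lra.
Qed.

Lemma majorant_upper (b : R) : 0 < b < 1 -> majorant b <= 2 / g.
Proof.
intros Ha. unfold majorant.
assert (0 <= 2 * Rpower (1 - b) (1 - g) / (1 - g)).
{ apply Rmult_le_pos; [pose proof (Rpower_pos (1 - b) (1
  - g)); lra | left; apply Rinv_0_lt_compat; lra]. }
assert (2 * Rpower b g / g <= 2 / g); [|lra].
apply Rmult_le_compat_r; [left; apply Rinv_0_lt_compat; lra|].
pose proof (Rpower_le_1 b g). lra.
Qed.

Lemma is_RInt_gen_beta (k : nat) :
  is_RInt_gen (beta_kernel k) (at_right 0) (at_left 1) (beta k) /\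
  forall a b, 0 < a <= b -> b < 1 -> RInt (beta_kernel k) a b <= beta k.
Proof.
destruct (ex_RInt_gen_nonneg (beta_kernel k) 0 1 (at_left 1) (2 / g + 2 / (1 - g))) as [l [Hl Hl2]].
- simpl; lra.
- intros b Hb. simpl in Hb. assert (Hd : 0 < 1 - b) by lra.
  exists (mkposreal _ Hd). intros y Hy Hy1. simpl.
  apply Rabs_def2 in Hy; unfold minus, plus, opp in Hy; simpl in Hy; lra.
- intros x Hx Hx1. apply continuous_beta_kernel. simpl in Hx1; lra.
- intros x _ _. left; apply beta_kernel_pos.
- intros a b Ha Hab Hb. simpl in Hb.
  pose proof (RInt_beta_kernel_le k a b ltac:(lra) Hb).
  pose proof (majorant_lower a ltac:(lra)). pose proof (majorant_upper b ltac:(lra)). lra.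
- unfold beta. rewrite (is_RInt_gen_unique (beta_kernel k) l Hl). split; [exact Hl|].
  intros a b Ha Hb. apply Hl2; simpl; lra.
Qed.

(** The missing mass is approached by the integrals over [a', a] and [b, b'] with a' near 0 and b'
    near 1; both are controlled by increments of [majorant], whose total outside [a, b] is at most
    [gap a b]. *)
Lemma beta_gap (k : nat) (a b : R) : 0 < a <= b -> b < 1 ->
  0 <= beta k - RInt (beta_kernel k) a b <= gap a b.
Proof.
intros Ha Hb. destruct (is_RInt_gen_beta k) as [H1 H2].
split; [pose proof (H2 a b Ha Hb); lra|].
apply le_epsilon. intros eps Heps.
destruct (proj1 (is_RInt_gen_oo _ _ _ _) H1 eps Heps) as [delta [Hd Hdd]].
set (a' := Rmin (a / 2) (delta / 2)). set (b' := Rmax ((1 + b) / 2) (1 - delta / 2)).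
assert (Ha' : 0 < a' <= a /\ a' < delta).
{ unfold a'. pose proof (Rmin_l (a / 2) (delta / 2)). pose proof (Rmin_r (a / 2) (delta / 2)).
  split; [split; [apply Rmin_pos|]|]; lra. }
assert (Hb' : b <= b' < 1 /\ 1 - delta < b').
{ unfold b'. pose proof (Rmax_l ((1 + b) / 2) (1 - delta / 2)).
  pose proof (Rmax_r ((1 + b) / 2) (1 - delta / 2)).
  split; [split; [|apply Rmax_lub_lt]|]; lra. }
destruct (Hdd a' b') as [y [Hy Hn]]; [lra | lra |].
apply Rabs_def2 in Hn. unfold minus, plus, opp in Hn; simpl in Hn.
assert (E : y = RInt (beta_kernel k) a' a + (RInt (beta_kernel k) a b + RInt (beta_kernel k) b b')).
{ rewrite <- (is_RInt_unique (beta_kernel k) a' b' y Hy).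
  rewrite <- (RInt_Chasles (beta_kernel k) a' a b'); [unfold plus; simpl; f_equal | |].
  - rewrite <- (RInt_Chasles (beta_kernel k) a b b'); [reflexivity | |];
    eexists; apply is_RInt_beta_kernel; lra.
  - eexists; apply is_RInt_beta_kernel; lra.
  - eexists; apply is_RInt_beta_kernel; lra. }
pose proof (RInt_beta_kernel_le k a' a ltac:(lra) ltac:(lra)).
pose proof (RInt_beta_kernel_le k b b' ltac:(lra) ltac:(lra)).
pose proof (majorant_lower a' ltac:(lra)). pose proof (majorant_upper b' ltac:(lra)).
unfold gap. lra.
Qed.

Lemma gap_small (eps : R) : 0 < eps ->
  exists delta, 0 < delta < / 2 /\
    forall a b, 0 < a < delta -> 1 - delta < b < 1 -> gap a b < eps.
Proof.
intros He.
destruct (Rpower_small g (eps * g / 8)) as [d1 [Hd1 H1]]; [lra | apply Rdiv_lt_0_compat; nra |].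
destruct (Rpower_small (1 - g) (eps * (1
  - g) / 8)) as [d2 [Hd2 H2]]; [lra | apply Rdiv_lt_0_compat; nra |].
set (d3 := Rmin (eps * g / 8) (eps * (1 - g) / 8)).
assert (Hd3 : 0 < d3) by (apply Rmin_pos; apply Rdiv_lt_0_compat; nra).
assert (Hd3' : d3 <= eps * g / 8 /\ d3 <= eps * (1 - g) / 8)
  by (split; [apply Rmin_l | apply Rmin_r]).
clearbody d3.
exists (Rmin (Rmin d1 d2) (Rmin d3 (/ 4))).
pose proof (Rmin_l (Rmin d1 d2) (Rmin d3 (/ 4))). pose proof (Rmin_r (Rmin d1 d2) (Rmin d3 (/ 4))).
pose proof (Rmin_l d1 d2). pose proof (Rmin_r d1 d2).
pose proof (Rmin_l d3 (/ 4)). pose proof (Rmin_r d3 (/ 4)).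
split. { split; [apply Rmin_pos; apply Rmin_pos; lra | lra]. }
intros a b Ha Hb.
pose proof (H1 a ltac:(lra)) as Ka. pose proof (H2 (1 - b) ltac:(lra)) as Kb.
(* Powers of numbers near 1 are bounded below by the base, so 1 - b^g <= 1 - b; only the powers of
   numbers near 0 need [Rpower_small]. *)
assert (Hlow : forall s y, 0 < s <= 1 -> 0 <= y <= 1 -> s <= Rpower s y).
{ intros s y Hs Hy. replace s with (Rpower s y * Rpower s (1 - y)) at 1.
  - pose proof (Rpower_pos s y). pose proof (Rpower_le_1 s (1 - y) Hs ltac:(lra)).
    nra.
  - rewrite <- Rpower_plus. replace (y + (1 - y)) with 1 by ring. apply Rpower_1; lra. }
pose proof (Hlow b g ltac:(lra) ltac:(lra)).
pose proof (Hlow (1 - a) (1 - g) ltac:(lra) ltac:(lra)).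
unfold gap, majorant.
assert (E1 : 2 / g - 2 * Rpower b g / g < eps / 4).
{ replace (2 / g - 2 * Rpower b g / g) with (2 * (1 - Rpower b g) / g) by (field; lra).
  apply Rlt_div_l; [lra|]. nra. }
assert (E2 : 2 / (1 - g) - 2 * Rpower (1 - a) (1 - g) / (1 - g) < eps / 4).
{ replace (2 / (1 - g) - 2 * Rpower (1 - a) (1 - g) / (1 - g))
    with (2 * (1 - Rpower (1 - a) (1 - g)) / (1 - g)) by (field; lra).
  apply Rlt_div_l; [lra|]. nra. }
assert (E3 : 2 * Rpower a g / g < eps / 4) by (apply Rlt_div_l; lra).
assert (E4 : 2 * Rpower (1 - b) (1 - g) / (1 - g) < eps / 4) by (apply Rlt_div_l; lra).
lra.
Qed.

Lemma beta_pos (k : nat) : 0 < beta k.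
Proof.
apply Rlt_le_trans with (RInt (beta_kernel k) (/ 4) (/ 2)).
- apply RInt_gt_0; [lra | |].
  + intros s _. apply beta_kernel_pos.
  + intros s Hs. apply continuous_beta_kernel. lra.
- apply is_RInt_gen_beta; lra.
Qed.

(** With q = g (k + 1), the density q s^(q - 1) on (0, 1) concentrates at 1 as k grows, exactly
    where (1 - s)^(- g) is large. This growth makes the ratios of successive coefficients tend to 0,
    hence the Mittag-Leffler series entire. *)
Lemma beta_growth (M : R) : exists N, forall k, (N <= k)%nat -> M <= g * INR (S k) * beta k.
Proof.
set (M' := Rmax M 1).
assert (HM : M <= M' /\ 1 <= M') by (split; [apply Rmax_l | apply Rmax_r]).
clearbody M'.
(* Chosen so that the factor (1 - s)^(- g) equals 2 M' at [a] and is larger to its right; M' >= 1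
   puts [a] inside (0, 1). *)
set (a := 1 - Rpower (2 * M') (- / g)).
assert (Ha : 0 < a < 1).
{ unfold a. pose proof (Rpower_pos (2 * M') (- / g)).
  assert (Rpower (2 * M') (- / g) < Rpower (2 * M') 0).
  { apply Rpower_lt; [lra|]. assert (0 < / g) by (apply Rinv_0_lt_compat; lra). lra. }
  rewrite Rpower_O in H0 by lra. lra. }
assert (Hpa : Rpower (1 - a) (- g) = 2 * M').
{ unfold a. replace (1 - (1 - Rpower (2 * M') (- / g))) with (Rpower (2 * M') (- / g)) by ring.
  rewrite Rpower_mult. replace (- / g * - g) with 1 by (field; lra). apply Rpower_1; lra. }
assert (Hla : ln a < 0) by (rewrite <- ln_1; apply ln_increasing; lra).
destruct (INR_unbounded (3 / (g * - ln a))) as [N HN].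
exists N. intros k Hk.
set (q := g * INR (S k)).
assert (Hq : 0 < q) by (pose proof (exponent_ge k); unfold q; lra).
assert (Haq : Rpower a q <= / 4).
{ assert (Hq2 : 3 < q * - ln a).
  { apply le_INR in Hk.
    assert (H3 : 3 < INR N * (g * - ln a)) by (apply Rlt_div_l; nra).
    assert (INR N * (g * - ln a) <= INR (S k) * (g * - ln a)); [|unfold q; lra].
    apply Rmult_le_compat_r; [nra|]. rewrite S_INR. lra. }
  unfold Rpower. replace (/ 4) with (/ (1 + 3)) by lra.
  replace (q * ln a) with (- (q * - ln a)) by ring. rewrite exp_Ropp.
  apply Rinv_le_contravar; [lra|].
  apply Rle_trans with (exp 3); [apply exp_ineq1_le | left; now apply exp_increasing]. }
(* The density q s^(q - 1) has mass b^q - a^q on [a, b]. As a^q <= 1/4 for large k, taking b^q = 3/4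
   leaves mass at least 1/2, which the factor 2 in 2 M' compensates. *)
set (b := Rpower (3 / 4) (/ q)).
assert (Hbq : Rpower b q = 3 / 4).
{ unfold b. rewrite Rpower_mult, Rinv_l by lra. apply Rpower_1; lra. }
assert (Hb0 : 0 < b) by apply Rpower_pos.
assert (Hb1 : b < 1).
{ apply Rnot_le_lt. intros H.
  assert (Rpower 1 q <= Rpower b q) by (apply Rpower_le_base; lra).
  unfold Rpower at 1 in H0. rewrite ln_1, Rmult_0_r, exp_0 in H0. lra. }
assert (Hab : a < b).
{ apply Rnot_le_lt. intros H.
  assert (Rpower b q <= Rpower a q) by (apply Rpower_le_base; lra). lra. }
pose proof (proj2 (is_RInt_gen_beta k) a b ltac:(lra) Hb1) as H1.
assert (H2 : is_RInt (fun s => 2 * M' * Rpower s (q - 1)) a b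
               (2 * M' / q * Rpower b q - 2 * M' / q * Rpower a q)).
{ apply (is_RInt_derive_on (fun s => 2 * M' / q * Rpower s q)); [lra | |].
  - intros s Hs.
    replace (2 * M' * Rpower s (q - 1)) with (2 * M' / q * (q * Rpower s (q - 1))) by (field; lra).
    apply (is_derive_scal (fun s => Rpower s q)). apply is_derive_Rpower; lra.
  - intros s Hs. apply continuous_Rmult; [apply continuous_const|]. apply continuous_Rpower; lra. }
assert (H3 : 2 * M' / q * Rpower b q - 2 * M' / q * Rpower a q <= RInt (beta_kernel k) a b).
{ apply (is_RInt_le _ (beta_kernel k) a b _ _ ltac:(lra) H2).
  - apply is_RInt_beta_kernel; lra.
  - intros s Hs. apply Rmult_le_compat_r; [left; apply Rpower_pos|].
    rewrite <- Hpa. apply Rpower_le_base_neg; lra. }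
apply Rle_trans with M'; [lra|].
apply Rle_trans with (q * (2 * M' / q * Rpower b q - 2 * M' / q * Rpower a q)).
- rewrite Hbq. replace (q * (2 * M' / q * (3 / 4) - 2 * M' / q * Rpower a q))
    with (2 * M' * (3 / 4 - Rpower a q)) by (field; lra). nra.
- apply Rmult_le_compat_l; lra.
Qed.

(* [coef k = 1 / Gamma (g k + 1)], but only this recurrence is used. *)
Fixpoint coef (k : nat) : R :=
  match k with
  | O => 1
  | S k => Gamma (1 - g) * coef k / (g * INR (S k) * beta k)
  end.

Lemma coef_denominator_pos (k : nat) : 0 < g * INR (S k) * beta k.
Proof.
apply Rmult_lt_0_compat; [|apply beta_pos]. pose proof (exponent_ge k). lra.
Qed.

Lemma coef_pos (k : nat) : 0 < coef k.
Proof.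
induction k as [|k IH]; simpl coef; [lra|].
apply Rdiv_lt_0_compat; [|apply coef_denominator_pos].
apply Rmult_lt_0_compat; [apply Gamma_pos; lra | exact IH].
Qed.

(** Written with [INR (S k) * coef (S k)] in front because this is the coefficient [dcoef k] of the
    derived series, integrated termwise below. *)
Lemma coef_succ (k : nat) : INR (S k) * coef (S k) * (g * beta k) = Gamma (1 - g) * coef k.
Proof.
change (coef (S k)) with (Gamma (1 - g) * coef k / (g * INR (S k) * beta k)).
pose proof (beta_pos k). pose proof (lt_0_INR (S k) ltac:(lia)).
generalize dependent (INR (S k)). intros r Hr. field. repeat split; apply Rgt_not_eq; lra.
Qed.

Lemma CV_radius_coef : CV_radius coef = p_infty.
Proof.
apply CV_radius_infinite_DAlembert.
- intros n. apply Rgt_not_eq, coef_pos.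
- apply is_lim_seq_spec. intros eps.
  pose proof (Gamma_pos (1 - g) ltac:(lra)) as HG.
  destruct (beta_growth (2 * Gamma (1 - g) / eps)) as [N HN].
  exists N. intros k Hk. specialize (HN k Hk).
  pose proof (coef_denominator_pos k) as HD. pose proof (coef_pos k) as Hc.
  pose proof (cond_pos eps) as He.
  change (coef (S k)) with (Gamma (1 - g) * coef k / (g * INR (S k) * beta k)).
  set (D := g * INR (S k) * beta k) in *.
  replace (Gamma (1 - g) * coef k / D / coef k) with (Gamma (1 - g) / D) by (field; lra).
  rewrite Rminus_0_r, Rabs_Rabsolu, Rabs_pos_eq
    by (left; apply Rdiv_lt_0_compat; lra).
  apply Rlt_div_l; [lra|].
  apply (proj1 (Rle_div_l _ _ _ He)) in HN. lra.
Qed.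

(** * The Mittag-Leffler function as an entire power series *)

Definition dcoef : nat -> R := PS_derive coef.

Lemma CV_radius_dcoef : CV_radius dcoef = p_infty.
Proof. unfold dcoef. rewrite CV_radius_derive. apply CV_radius_coef. Qed.

Lemma dcoef_pos (k : nat) : 0 < dcoef k.
Proof.
apply Rmult_lt_0_compat; [apply lt_0_INR; lia | apply coef_pos].
Qed.

(* The Mittag-Leffler function [z |-> E_g(z)]. *)
Definition ml (z : R) : R := PSeries coef z.
Definition dml (z : R) : R := PSeries dcoef z.
Definition ddml (z : R) : R := PSeries (PS_derive dcoef) z.

Lemma is_derive_ml (z : R) : is_derive ml z (dml z).
Proof. apply is_derive_PSeries. now rewrite CV_radius_coef. Qed.

Lemma is_derive_dml (z : R) : is_derive dml z (ddml z).
Proof. apply is_derive_PSeries. now rewrite CV_radius_dcoef. Qed.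

Lemma continuous_ml (z : R) : continuous ml z.
Proof. apply (ex_derive_continuous ml). eexists. apply is_derive_ml. Qed.

Lemma continuous_dml (z : R) : continuous dml z.
Proof. apply (ex_derive_continuous dml). eexists. apply is_derive_dml. Qed.

Lemma ml_0 : ml 0 = 1.
Proof. unfold ml. rewrite PSeries_0. reflexivity. Qed.

Lemma dml_bounded (X : R) :
  exists M, 0 < M /\ forall z, Rabs z <= X -> Rabs (dml z) <= M /\ Rabs (ddml z) <= M.
Proof.
destruct (bounded_continuity dml (- X) X) as [M1 H1].
{ intros z _. apply continuous_dml. }
destruct (bounded_continuity ddml (- X) X) as [M2 H2].
{ intros z _. apply continuity_pt_filterlim. apply PSeries_continuity.
  rewrite CV_radius_derive, CV_radius_dcoef. exact I. }
exists (Rmax 1 (Rmax M1 M2)).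
pose proof (Rmax_l 1 (Rmax M1 M2)). pose proof (Rmax_r 1 (Rmax M1 M2)).
pose proof (Rmax_l M1 M2). pose proof (Rmax_r M1 M2).
split; [lra|]. intros z Hz. apply Rabs_le_between in Hz.
specialize (H1 z Hz). specialize (H2 z Hz).
change (Rabs (dml z) < M1) in H1. change (Rabs (ddml z) < M2) in H2. lra.
Qed.

Lemma mean_value_bound (f df : R -> R) (X M x y : R) :
  (forall z, is_derive f z (df z)) -> (forall z, Rabs z <= X -> Rabs (df z) <= M) ->
  Rabs x <= X -> Rabs y <= X -> Rabs (f y - f x) <= M * Rabs (y - x).
Proof.
intros Hf Hb Hx Hy.
destruct (MVT_gen f x y df) as [c [Hc Hfc]].
- intros z _. apply Hf.
- intros z _. apply continuity_pt_filterlim. apply (ex_derive_continuous f).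
  eexists. apply Hf.
- rewrite Hfc, Rabs_mult. apply Rmult_le_compat_r; [apply Rabs_pos|]. apply Hb.
  apply Rabs_le_between in Hx. apply Rabs_le_between in Hy. apply Rabs_le_between.
  unfold Rmin, Rmax in Hc. destruct (Rle_dec x y); lra.
Qed.

(** The mean value theorem applied to [f] and then to [df], whence M in place of the usual M / 2.
    The constant depends on X alone, which later makes the bound uniform over the eigenvalues. *)
Lemma taylor_bound (f df ddf : R -> R) (X M x y : R) :
  (forall z, is_derive f z (df z)) -> (forall z, is_derive df z (ddf z)) ->
  (forall z, Rabs z <= X -> Rabs (ddf z) <= M) ->
  Rabs x <= X -> Rabs y <= X -> Rabs (f y - f x - df x * (y - x)) <= M * (y - x) ^ 2.
Proof.
intros Hf Hdf Hb Hx Hy.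
destruct (MVT_gen f x y df) as [c [Hc Hfc]].
- intros z _. apply Hf.
- intros z _. apply continuity_pt_filterlim. apply (ex_derive_continuous f).
  eexists. apply Hf.
- assert (HcX : Rabs c <= X /\ Rabs (c - x) <= Rabs (y - x)).
  { apply Rabs_le_between in Hx. apply Rabs_le_between in Hy.
    unfold Rmin, Rmax in Hc. split; [apply Rabs_le_between; destruct (Rle_dec x y); lra|].
    destruct (Rle_dec x y); [rewrite !Rabs_pos_eq by lra | rewrite !Rabs_left1 by lra]; lra. }
  replace (f y - f x - df x * (y - x)) with ((df c - df x) * (y - x)) by (rewrite Hfc; ring).
  rewrite Rabs_mult, <- pow2_abs.
  pose proof (mean_value_bound df ddf X M x c Hdf Hb Hx (proj1 HcX)).
  pose proof (Rabs_pos (y - x)). pose proof (Rabs_pos (c - x)).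
  assert (0 <= M) by (apply Rle_trans with (2 := Hb x Hx); apply Rabs_pos).
  apply Rle_trans with ((M * Rabs (y - x)) * Rabs (y - x)); [|lra].
  apply Rmult_le_compat_r; [lra|]. apply Rle_trans with (1 := H).
  apply Rmult_le_compat_l; lra.
Qed.

(** * Termwise fractional differentiation *)

Lemma Rabs_sum_n_le (a b : nat -> R) (N : nat) :
  (forall k, Rabs (a k) <= b k) -> Rabs (sum_n a N) <= sum_n b N.
Proof.
intros H. induction N as [|N IH]; [rewrite !sum_O; apply H|].
rewrite !sum_Sn. apply Rle_trans with (1 := Rabs_triang _ _). now apply Rplus_le_compat.
Qed.

Lemma series_tail_bound (a b : nat -> R) (N : nat) :
  (forall k, Rabs (a k) <= b k) -> ex_series b ->
  Rabs (Series a - sum_n a N) <= Series b - sum_n b N.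
Proof.
intros H Hb.
assert (Ha : ex_series (fun k => Rabs (a k))).
{ apply (ex_series_le (fun k => Rabs (a k)) b); [|exact Hb].
  intros k. unfold norm; simpl; unfold abs; simpl. now rewrite Rabs_Rabsolu. }
rewrite (Series_incr_n a (S N)) by (try lia; now apply ex_series_Rabs).
rewrite (Series_incr_n b (S N)) by (try lia; auto).
simpl Init.Nat.pred. rewrite <- !sum_n_Reals.
match goal with |- Rabs (?x + ?y - ?x) <= ?u + ?v - ?u =>
  replace (x + y - x) with y by ring; replace (u + v - u) with v by ring end.
apply Rle_trans with (1 := Series_Rabs _ (proj1 (ex_series_incr_n (fun k => Rabs (a k)) (S N)) Ha)).
apply Series_le.
- intros k. split; [apply Rabs_pos | apply H].
- now apply (ex_series_incr_n b).
Qed.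

Lemma is_RInt_sum_n (f : nat -> R -> R) (l : nat -> R) (a b : R) (N : nat) :
  (forall k, is_RInt (f k) a b (l k)) ->
  is_RInt (fun s => sum_n (fun k => f k s) N) a b (sum_n l N).
Proof.
intros H. induction N as [|N IH].
- rewrite sum_O. apply (is_RInt_ext (f O)); [|apply H]. intros s _. now rewrite sum_O.
- rewrite sum_Sn. apply (is_RInt_ext (fun s => plus (sum_n (fun k => f k s) N) (f (S N) s))).
  + intros s _. now rewrite sum_Sn.
  + now apply (is_RInt_plus (fun s => sum_n (fun k => f k s) N)).
Qed.

Lemma ex_series_ml (x : R) : ex_series (fun k => coef k * x ^ k).
Proof. apply (proj1 (ex_pseries_R _ _)), CV_radius_inside. now rewrite CV_radius_coef. Qed.

Lemma ex_series_dml (x : R) : ex_series (fun k => dcoef k * x ^ k).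
Proof. apply (proj1 (ex_pseries_R _ _)), CV_radius_inside. now rewrite CV_radius_dcoef. Qed.

Lemma ml_Series (x : R) : ml x = Series (fun k => coef k * x ^ k).
Proof. reflexivity. Qed.

Lemma dml_Series (x : R) : dml x = Series (fun k => dcoef k * x ^ k).
Proof. reflexivity. Qed.

Lemma Rabs_pow_le (x y : R) (k : nat) : Rabs x <= y -> Rabs (x ^ k) <= y ^ k.
Proof. intros H. rewrite <- RPow_abs. apply pow_incr. split; [apply Rabs_pos | exact H]. Qed.

(** Each further power of s^g from the series of [dml (x * Rpower s g)] raises the index of the Beta
    kernel by one. *)
Lemma beta_kernel_power (k : nat) (s : R) : 0 < s < 1 ->
  beta_kernel k s = beta_kernel 0 s * Rpower s g ^ k.
Proof.
intros Hs. unfold beta_kernel. rewrite <- Rpower_pow by apply Rpower_pos.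
rewrite Rpower_mult, Rmult_assoc, <- Rpower_plus. do 2 f_equal.
rewrite S_INR. simpl INR. ring.
Qed.

Lemma sum_n_sub_scal (u v : nat -> R) (c : R) (N : nat) :
  sum_n u N - c * sum_n v N = sum_n (fun k => u k - c * v k) N.
Proof.
induction N as [|N IH]; [now rewrite !sum_O|].
rewrite !sum_Sn. rewrite <- IH.
change (sum_n u N + u (S N) - c * (sum_n v N + v (S N))
        = sum_n u N - c * sum_n v N + (u (S N) - c * v (S N))). ring.
Qed.

Lemma sum_n_le_Series (a : nat -> R) (N : nat) :
  (forall k, 0 <= a k) -> ex_series a -> sum_n a N <= Series a.
Proof.
intros H Ha.
assert (Rabs (Series a - sum_n a N) <= Series a - sum_n a N).
{ apply series_tail_bound; [|exact Ha]. intros k. right. now apply Rabs_pos_eq. }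
pose proof (Rabs_pos (Series a - sum_n a N)). lra.
Qed.

Lemma term_le_Series (a : nat -> R) (N : nat) :
  (forall k, 0 <= a k) -> ex_series a -> a N <= Series a.
Proof.
intros H Ha. apply Rle_trans with (2 := sum_n_le_Series a N H Ha).
destruct N as [|N]; [rewrite sum_O; apply Rle_refl|]. rewrite sum_Sn.
change (a (S N) <= sum_n a N + a (S N)).
enough (0 <= sum_n a N) by lra. induction N as [|N IH]; [rewrite sum_O; apply H|].
rewrite sum_Sn. apply Rplus_le_le_0_compat; [exact IH | apply H].
Qed.

Lemma dml_nonneg (X : R) : 0 <= X -> 0 <= dml X.
Proof.
intros HX. rewrite dml_Series.
assert (H : forall k, 0 <= dcoef k * X ^ k).
{ intros k. apply Rmult_le_pos; [left; apply dcoef_pos | now apply pow_le]. }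
apply Rle_trans with (2 := sum_n_le_Series _ O H (ex_series_dml X)).
rewrite sum_O. apply H.
Qed.

(** The Caputo integrand at time 1 of the function s |-> E_g(x s^g). *)
Definition unit_kernel (x s : R) : R :=
  Rpower (1 - s) (- g) * (g * x * Rpower s (g - 1) * dml (x * Rpower s g)).

Lemma continuous_unit_kernel (x s : R) : 0 < s < 1 -> continuous (unit_kernel x) s.
Proof.
intros Hs. apply continuous_Rmult.
{ apply (continuous_reflect (fun r => Rpower r (- g))). apply continuous_Rpower; lra. }
apply continuous_Rmult.
{ apply continuous_Rmult; [apply continuous_const | apply continuous_Rpower; lra]. }
apply (continuous_comp (fun r => x * Rpower r g) dml); [|apply continuous_dml].
apply continuous_Rmult; [apply continuous_const | apply continuous_Rpower; lra].
Qed.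

(* Termwise, [coef_succ] turns the integral over the whole of [0, 1] into
   [Gamma (1 - g) x ml x]; the bound [gap] on the tails is common to all the terms. *)
Lemma truncated_unit_caputo (X x a b : R) : Rabs x <= X -> 0 < a <= b -> b < 1 ->
  Rabs (RInt (unit_kernel x) a b - Gamma (1 - g) * x * ml x) <= gap a b * (g * X * dml X).
Proof.
intros HxX Ha Hb.
assert (HX : 0 <= X) by (apply Rle_trans with (2 := HxX); apply Rabs_pos).
set (I := RInt (unit_kernel x) a b).
assert (HI : is_RInt (unit_kernel x) a b I).
{ apply (RInt_correct (unit_kernel x)), ex_RInt_continuous_on; [lra|].
  intros s Hs. apply continuous_unit_kernel; lra. }
set (d := fun k => dcoef k * x ^ k).
set (D := fun k => dcoef k * X ^ k).
set (rho := fun N => Series D - sum_n D N).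
assert (HdD : forall k y, Rabs y <= X -> Rabs (dcoef k * y ^ k) <= D k).
{ intros k y Hy. unfold D. rewrite Rabs_mult, (Rabs_pos_eq (dcoef k)) by (left; apply dcoef_pos).
  apply Rmult_le_compat_l; [left; apply dcoef_pos | now apply Rabs_pow_le]. }
assert (HD : ex_series D) by apply ex_series_dml.
assert (Hrho : forall N, 0 <= rho N).
{ intros N. unfold rho. apply Rge_le, Rge_minus, Rle_ge. apply sum_n_le_Series; [|exact HD].
  intros k. apply Rmult_le_pos; [left; apply dcoef_pos | now apply pow_le]. }
(* Replacing [dml] by its N-th partial sum costs at most the tail [rho N] of the majorant series,
   multiplied pointwise by [beta_kernel 0], whose integral over [a, b] is at most [beta 0]. *)
assert (H1 : forall N, Rabs (I - sum_n (fun k => g * x * d k * RInt (beta_kernel k) a b) N)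
                       <= beta 0 * (g * X * rho N)).
{ intros N.
  assert (HT : is_RInt (fun s => sum_n (fun k => g * x * d k * beta_kernel k s) N) a b
                 (sum_n (fun k => g * x * d k * RInt (beta_kernel k) a b) N)).
  { apply is_RInt_sum_n. intros k. apply (is_RInt_scal (beta_kernel k)).
    now apply is_RInt_beta_kernel. }
  pose proof (is_RInt_minus _ _ _ _ _ _ HI HT) as HIT.
  assert (Hk0 : is_RInt (fun s => beta_kernel 0 s * (g * X * rho N)) a b
                  (RInt (beta_kernel 0) a b * (g * X * rho N))).
  { apply (is_RInt_ext (fun s => scal (g * X * rho N) (beta_kernel 0 s))).
    - intros s _. unfold scal; simpl; unfold mult; simpl. ring.
    - replace (RInt (beta_kernel 0) a b * (g * X * rho N))
      with (scal (g * X * rho N) (RInt (beta_kernel 0) a b))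
        by (unfold scal; simpl; unfold mult; simpl; ring).
      apply (is_RInt_scal (beta_kernel 0)). now apply is_RInt_beta_kernel. }
  specialize (Hrho N).
  apply Rle_trans with (RInt (beta_kernel 0) a b * (g * X * rho N)).
  2:{ apply Rmult_le_compat_r; [apply Rmult_le_pos; nra|]. apply is_RInt_gen_beta; lra. }
  apply (norm_RInt_le _ _ a b _ _ ltac:(lra)) with (2 := HIT) (3 := Hk0).
  intros s Hs.
  set (y := x * Rpower s g).
  assert (Hy : Rabs y <= X).
  { unfold y. rewrite Rabs_mult, (Rabs_pos_eq (Rpower s g)) by (left; apply Rpower_pos).
    pose proof (Rpower_le_1 s g ltac:(lra) ltac:(lra)). pose proof (Rabs_pos x).
    pose proof (Rpower_pos s g). nra. }
  change (Rabs (unit_kernel x s - sum_n (fun k => g * x * d k * beta_kernel k s) N)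
          <= beta_kernel 0 s * (g * X * rho N)).
  assert (E : unit_kernel x s - sum_n (fun k => g * x * d k * beta_kernel k s) N
     = beta_kernel 0 s * (g * x) * (Series (fun k => dcoef k * y ^ k)
       - sum_n (fun k => dcoef k * y ^ k) N)).
  { rewrite <- dml_Series.
    replace (sum_n (fun k => g * x * d k * beta_kernel k s) N)
      with (beta_kernel 0 s * (g * x) * sum_n (fun k => dcoef k * y ^ k) N).
    - unfold unit_kernel, beta_kernel at 2. fold y.
      replace (g * INR 1) with g by (simpl; ring). unfold beta_kernel.
      replace (g * INR 1) with g by (simpl; ring). ring.
    - rewrite <- (sum_n_mult_l (K := R_Ring)). apply sum_n_ext. intros k.
      unfold mult; simpl. rewrite (beta_kernel_power k) by lra. unfold d, y.
      rewrite Rpow_mult_distr. ring. }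
  rewrite E.
  rewrite !Rabs_mult, (Rabs_pos_eq (beta_kernel 0 s)), (Rabs_pos_eq g), Rmult_assoc
    by (try lra; left; apply beta_kernel_pos).
  apply Rmult_le_compat_l; [left; apply beta_kernel_pos|].
  apply Rmult_le_compat; [pose proof (Rabs_pos x); nra | apply Rabs_pos | nra |].
  apply (series_tail_bound (fun k => dcoef k * y ^ k) D N); auto. }
(* Each truncated Beta integral is completed to [beta k]: by [coef_succ] the completed terms are
   those of Gamma (1 - g) x E_g(x), and each completion costs at most [gap a b] times the majorant
   term. *)
assert (H2 : forall N,
  Rabs (sum_n (fun k => g * x * d k * RInt (beta_kernel k) a b) N
        - Gamma (1 - g) * x * sum_n (fun k => coef k * x ^ k) N) <= gap a b * (g * X * dml X)).
{ intros N.
  assert (Hgap : 0 <= gap a b) by (pose proof (beta_gap 0 a b Ha Hb); lra).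
  replace (sum_n (fun k => g * x * d k * RInt (beta_kernel k) a b) N
        - Gamma (1 - g) * x * sum_n (fun k => coef k * x ^ k) N)
    with (sum_n (fun k => g * x * d k * (RInt (beta_kernel k) a b - beta k)) N).
  2:{ rewrite sum_n_sub_scal. apply sum_n_ext. intros k.
      pose proof (coef_succ k) as Hk. unfold d, dcoef, PS_derive.
      apply Rminus_diag_uniq.
      transitivity (x * x ^ k * (Gamma (1 - g) * coef k
        - INR (S k) * coef (S k) * (g * beta k))); [ring|].
      rewrite Hk. ring. }
  apply Rle_trans with (sum_n (fun k => gap a b * (g * X) * D k) N).
  - apply Rabs_sum_n_le. intros k.
    rewrite !Rabs_mult, (Rabs_pos_eq g) by lra.
    pose proof (beta_gap k a b Ha Hb).
    assert (Hr : Rabs (RInt (beta_kernel k) a b - beta k) <= gap a b)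
      by (apply Rabs_le_between; lra).
    replace (gap a b * (g * X) * D k) with (g * X * D k * gap a b) by ring.
    apply Rmult_le_compat; [| apply Rabs_pos | | exact Hr].
    + apply Rmult_le_pos; [pose proof (Rabs_pos x); nra | apply Rabs_pos].
    + apply Rmult_le_compat; [pose proof (Rabs_pos x); nra | apply Rabs_pos | nra | now apply HdD].
  - rewrite (sum_n_mult_l (K := R_Ring)).
    change (gap a b * (g * X) * sum_n D N <= gap a b * (g * X * dml X)).
    rewrite (Rmult_assoc (gap a b)).
    apply Rmult_le_compat_l; [exact Hgap|]. apply Rmult_le_compat_l; [nra|].
    pose proof (Hrho N). rewrite dml_Series. unfold rho, D in *. lra. }
assert (L1 : is_lim_seq (fun N => Rabs (I - Gamma (1 - g) * x * sum_n (fun k => coef k * x ^ k) N))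
               (Rabs (I - Gamma (1 - g) * x * ml x))).
{ apply (is_lim_seq_abs _ (Finite _)). apply is_lim_seq_minus'; [apply is_lim_seq_const|].
  apply (is_lim_seq_scal_l _ (Gamma (1 - g) * x) (Finite _)).
  rewrite ml_Series. apply (Series_correct _ (ex_series_ml x)). }
assert (L2 : is_lim_seq (fun N => beta 0 * (g * X * rho N) + gap a b * (g * X * dml X))
               (beta 0 * (g * X * (Series D - Series D)) + gap a b * (g * X * dml X))).
{ apply is_lim_seq_plus'; [|apply is_lim_seq_const].
  apply (is_lim_seq_scal_l _ (beta 0) (Finite _)). apply (is_lim_seq_scal_l _ (g * X) (Finite _)).
  apply is_lim_seq_minus'; [apply is_lim_seq_const | apply (Series_correct _ HD)]. }
(* As N tends to infinity [rho N] tends to 0, so only the cost of the completion remains. *)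
assert (Hle := fun N => Rle_trans _ _ _ (Rabs_triang _ _) (Rplus_le_compat _ _ _ _ (H1 N) (H2 N))).
apply Rle_trans with (beta 0 * (g * X * (Series D
  - Series D)) + gap a b * (g * X * dml X)); [|right; ring].
refine (is_lim_seq_le _ _ (Finite _) (Finite _) _ L1 L2).
intros N. apply Rle_trans with (2 := Hle N). right. f_equal. ring.
Qed.

(** * Relaxation functions and the maximum principle *)

(* [Rpower 0 g] is [1], not [0]. *)
Definition tpow (t : R) : R := if Rle_dec t 0 then 0 else Rpower t g.

Lemma tpow_pos (t : R) : 0 < t -> tpow t = Rpower t g.
Proof. intros Ht. unfold tpow. destruct (Rle_dec t 0); [lra | reflexivity]. Qed.

Lemma tpow_0 : tpow 0 = 0.
Proof. unfold tpow. destruct (Rle_dec 0 0); lra. Qed.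

Lemma tpow_1 : tpow 1 = 1.
Proof. rewrite tpow_pos by lra. unfold Rpower. now rewrite ln_1, Rmult_0_r, exp_0. Qed.

Lemma tpow_nonneg (t : R) : 0 <= tpow t.
Proof. unfold tpow. destruct (Rle_dec t 0); [lra | left; apply Rpower_pos]. Qed.

Lemma tpow_le (s t : R) : s <= t -> tpow s <= tpow t.
Proof.
intros Hst. destruct (Rle_dec s 0).
- unfold tpow at 1. destruct (Rle_dec s 0); [apply tpow_nonneg | contradiction].
- rewrite !tpow_pos by lra. apply Rpower_le_base; lra.
Qed.

Lemma locally_eq_pos {U : Type} (f h : R -> U) (t : R) :
  (forall s, 0 < s -> f s = h s) -> 0 < t -> locally t (fun s => f s = h s).
Proof.
intros H Ht. exists (mkposreal t Ht). intros s Hs. apply H.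
apply Rabs_def2 in Hs; unfold minus, plus, opp in Hs; simpl in Hs; lra.
Qed.

Lemma is_derive_tpow (t : R) : 0 < t -> is_derive tpow t (g * Rpower t (g - 1)).
Proof.
intros Ht. apply (is_derive_ext_loc (fun s => Rpower s g)).
- apply locally_eq_pos; [|exact Ht]. intros s Hs. now rewrite tpow_pos.
- now apply is_derive_Rpower.
Qed.

Lemma continuous_tpow (t : R) : continuous tpow t.
Proof.
destruct (total_order_T t 0) as [[Ht|Ht]|Ht].
- apply (continuous_ext_loc _ (fun _ => 0)); [|apply continuous_const].
  assert (Hd : 0 < - t) by lra. exists (mkposreal _ Hd). intros s Hs.
  apply Rabs_def2 in Hs; unfold minus, plus, opp in Hs; simpl in Hs.
  unfold tpow. destruct (Rle_dec s 0); [reflexivity | lra].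
- subst t. intros P [eps HP].
  destruct (Rpower_small g eps ltac:(lra) (cond_pos eps)) as [delta [Hd H]].
  exists (mkposreal _ Hd). intros s Hs. apply HP. rewrite tpow_0.
  apply Rabs_def2 in Hs; unfold minus, plus, opp in Hs; simpl in Hs.
  change (Rabs (tpow s - 0) < eps). rewrite Rminus_0_r, Rabs_pos_eq by apply tpow_nonneg.
  unfold tpow. destruct (Rle_dec s 0); [apply cond_pos | apply H; lra].
- apply (ex_derive_continuous tpow). eexists. now apply is_derive_tpow.
Qed.

Definition relax (mu t : R) : R := ml (- (mu * tpow t)).
Definition drelax (mu t : R) : R := - mu * (g * Rpower t (g - 1)) * dml (- (mu * tpow t)).

Lemma is_derive_relax (mu t : R) : 0 < t -> is_derive (relax mu) t (drelax mu t).
Proof.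
intros Ht. unfold relax, drelax.
replace (- mu * (g * Rpower t (g - 1)) * dml (- (mu * tpow t)))
  with (scal (- mu * (g * Rpower t (g - 1))) (dml (- (mu * tpow t)))) by reflexivity.
apply (is_derive_comp ml (fun t => - (mu * tpow t))); [apply is_derive_ml|].
apply (is_derive_ext (fun t => - mu * tpow t)).
- intros s. symmetry. apply Ropp_mult_distr_l.
- apply (is_derive_scal tpow). now apply is_derive_tpow.
Qed.

Lemma continuous_dml_tpow (mu t : R) : continuous (fun s => dml (- (mu * tpow s))) t.
Proof.
apply (continuous_comp (fun s => - (mu * tpow s)) dml); [|apply continuous_dml].
apply (continuous_opp (fun s => mu * tpow s)).
apply continuous_Rmult; [apply continuous_const | apply continuous_tpow].
Qed.

Lemma continuous_drelax (mu t : R) : 0 < t -> continuous (drelax mu) t.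
Proof.
intros Ht. apply continuous_Rmult; [|apply continuous_dml_tpow].
apply continuous_Rmult; [apply continuous_const|].
apply continuous_Rmult; [apply continuous_const | now apply continuous_Rpower].
Qed.

Lemma continuous_relax (mu t : R) : continuous (relax mu) t.
Proof.
apply (continuous_comp (fun s => - (mu * tpow s)) ml); [|apply continuous_ml].
apply (continuous_opp (fun s => mu * tpow s)).
apply continuous_Rmult; [apply continuous_const | apply continuous_tpow].
Qed.

Lemma relax_0 (mu : R) : relax mu 0 = 1.
Proof. unfold relax. rewrite tpow_0, Rmult_0_r, Ropp_0. apply ml_0. Qed.

Lemma relax_1 (mu : R) : relax mu 1 = ml (- mu).
Proof. unfold relax. now rewrite tpow_1, Rmult_1_r. Qed.

(** The substitution s = t r reduces time t to time 1 with x = - mu t^g. The argument is left as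
    [/ t * s + 0] to match the affine change of variable in [is_RInt_comp_lin]. *)
Lemma caputo_integrand_scaled (mu t s : R) : 0 < s < t ->
  Rpower (t - s) (- g) * drelax mu s
  = Rpower t (- g) * (/ t * unit_kernel (- (mu * tpow t)) (/ t * s + 0)).
Proof.
intros Hs. unfold unit_kernel, drelax. rewrite !tpow_pos by lra.
assert (Ht : 0 < / t) by (apply Rinv_0_lt_compat; lra).
replace (1 - (/ t * s + 0)) with (/ t * (t - s)) by (field; lra).
rewrite Rplus_0_r.
rewrite <- !(Rpower_mult_distr (/ t)) by lra.
assert (Hinv : forall y, Rpower (/ t) y = Rpower t (- y)).
{ intros y. unfold Rpower. rewrite ln_Rinv by lra. f_equal. ring. }
rewrite !Hinv, Ropp_involutive.
assert (H1 : Rpower t (- (g - 1)) * Rpower t g = t).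
{ rewrite <- Rpower_plus. replace (- (g - 1) + g) with 1 by ring. apply Rpower_1; lra. }
assert (H2 : Rpower t (- g) * Rpower t g = 1).
{ rewrite <- Rpower_plus. replace (- g + g) with 0 by ring. apply Rpower_O; lra. }
replace (- (mu * Rpower t g) * (Rpower t (- g) * Rpower s g))
  with (- (mu * Rpower s g) * (Rpower t (- g) * Rpower t g)) by ring.
rewrite H2, Rmult_1_r. set (m := dml _).
transitivity ((Rpower t (- g) * Rpower t g) * (Rpower t (- (g - 1)) * Rpower t g * / t)
   * (Rpower (t - s) (- g) * (- mu * (g * Rpower s (g - 1)) * m))); [|ring].
rewrite H1, H2. field. lra.
Qed.

(** The same [delta] serves all [mu] with |mu| <= M. [caputo_evol] depends on this uniformity, since
    it treats all the eigenvalues at once. *)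
Lemma truncated_caputo_relax (M t eps : R) : 0 < t -> 0 < eps ->
  exists delta, 0 < delta /\ forall mu a b, Rabs mu <= M -> 0 < a < delta -> t - delta < b < t ->
    exists y, is_RInt (fun s => Rpower (t - s) (- g) * drelax mu s) a b y /\
      Rabs (y - - (Gamma (1 - g) * mu * relax mu t)) < eps.
Proof.
intros Ht He.
set (X := Rmax 0 (M * tpow t)).
assert (HX : 0 <= X /\ M * tpow t <= X) by (split; [apply Rmax_l | apply Rmax_r]).
pose proof (dml_nonneg X (proj1 HX)) as HdX.
set (C := Rpower t (- g) * (g * X * dml X)).
assert (HC : 0 <= C).
{ apply Rmult_le_pos; [left; apply Rpower_pos|]. apply Rmult_le_pos; [nra | exact HdX]. }
(* [C] is the factor of [gap] in the final estimate; it may vanish, hence C + 1 in the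
   denominator. *)
destruct (gap_small (eps / (C + 1))) as [d [Hd Hgap]]; [apply Rdiv_lt_0_compat; lra|].
exists (d * t). split; [nra|]. intros mu a b Hmu Ha Hb.
assert (Hit : 0 < / t) by (apply Rinv_0_lt_compat; lra).
assert (Ha' : 0 < / t * a < d).
{ split; [nra|]. replace d with (/ t * (d * t)) by (field; lra). apply Rmult_lt_compat_l; lra. }
assert (Hb' : 1 - d < / t * b < 1).
{ split.
  - replace (1 - d) with (/ t * (t - d * t)) by (field; lra). apply Rmult_lt_compat_l; lra.
  - rewrite <- (Rinv_l t) by lra. apply Rmult_lt_compat_l; lra. }
assert (Hab : a < b).
{ apply (Rmult_lt_reg_l (/ t)); lra. }
set (x := - (mu * tpow t)).
assert (HxX : Rabs x <= X).
{ unfold x. rewrite Rabs_Ropp, Rabs_mult, (Rabs_pos_eq (tpow t)) by apply tpow_nonneg.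
  apply Rle_trans with (2 := proj2 HX). apply Rmult_le_compat_r; [apply tpow_nonneg | exact Hmu]. }
pose proof (truncated_unit_caputo X x (/ t * a) (/ t * b) HxX ltac:(lra) ltac:(lra)) as Htr.
set (I := RInt (unit_kernel x) (/ t * a) (/ t * b)) in *.
exists (Rpower t (- g) * I). split.
- apply (is_RInt_ext (fun s => scal (Rpower t (- g)) (scal (/ t) (unit_kernel x (/ t * s + 0))))).
  + intros s Hs. rewrite Rmin_left, Rmax_right in Hs by lra.
    rewrite caputo_integrand_scaled by lra. reflexivity.
  + apply (is_RInt_scal (fun s => scal (/ t) (unit_kernel x (/ t * s + 0)))).
    apply (is_RInt_comp_lin (unit_kernel x)). rewrite !Rplus_0_r.
    apply (RInt_correct (unit_kernel x)), ex_RInt_continuous_on; [lra|].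
    intros s Hs. apply continuous_unit_kernel; lra.
- assert (Htt : Rpower t (- g) * tpow t = 1).
  { rewrite tpow_pos, <- Rpower_plus by lra. replace (- g + g) with 0 by ring. apply Rpower_O; lra.
    }
  replace (Rpower t (- g) * I - - (Gamma (1 - g) * mu * relax mu t))
    with (Rpower t (- g) * (I - Gamma (1 - g) * x * ml x)).
  2:{ transitivity (Rpower t (- g) * I + (Rpower t (- g) * tpow t) * (Gamma (1
    - g) * mu * relax mu t)).
      - unfold x, relax. ring.
      - rewrite Htt. ring. }
  rewrite Rabs_mult, Rabs_pos_eq by (left; apply Rpower_pos).
  apply Rle_lt_trans with (C * gap (/ t * a) (/ t * b)).
  + unfold C. rewrite (Rmult_assoc (Rpower t (- g))).
    apply Rmult_le_compat_l; [left; apply Rpower_pos | lra].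
  + specialize (Hgap _ _ Ha' Hb').
    pose proof (beta_gap 0 (/ t * a) (/ t * b) ltac:(lra) ltac:(lra)).
    apply Rle_lt_trans with ((C + 1) * gap (/ t * a) (/ t * b)); [nra|].
    apply (Rmult_lt_compat_l (C + 1)) in Hgap; [|lra].
    replace ((C + 1) * (eps / (C + 1))) with eps in Hgap by (field; lra). exact Hgap.
Qed.

(* [J t] is [Gamma (1 - g)] times the Caputo derivative of [z] at [t]. *)
Definition has_caputo (T : R) (z dz J : R -> R) : Prop :=
  filterlim z (at_right 0) (locally (z 0)) /\
  forall t, 0 < t < T ->
    is_derive z t (dz t) /\ continuous dz t /\
    is_RInt_gen (fun s => Rpower (t - s) (- g) * dz s) (at_right 0) (at_left t) (J t).

Lemma continuous_at_right (f : R -> R) (x : R) :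
  continuous f x -> filterlim f (at_right x) (locally (f x)).
Proof. intros H. apply filterlim_filter_le_1 with (2 := H). apply filter_le_within. Qed.

Lemma has_caputo_relax (T mu : R) :
  has_caputo T (relax mu) (drelax mu) (fun t => - (Gamma (1 - g) * mu * relax mu t)).
Proof.
split; [apply continuous_at_right, continuous_relax|].
intros t Ht. split; [apply is_derive_relax; lra|]. split; [apply continuous_drelax; lra|].
apply is_RInt_gen_oo. intros eps He.
destruct (truncated_caputo_relax (Rabs mu) t eps ltac:(lra) He) as [delta [Hd H]].
exists delta. split; [exact Hd|]. intros a b Ha Hb. rewrite Rplus_0_l in Ha.
exact (H mu a b (Rle_refl _) Ha Hb).
Qed.

Lemma has_caputo_lin (T c1 c2 : R) (z1 z2 dz1 dz2 J1 J2 : R -> R) :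
  has_caputo T z1 dz1 J1 -> has_caputo T z2 dz2 J2 ->
  has_caputo T (fun t => c1 * z1 t + c2 * z2 t) (fun t => c1 * dz1 t + c2 * dz2 t)
    (fun t => c1 * J1 t + c2 * J2 t).
Proof.
intros [H1 K1] [H2 K2]. split.
- apply (filterlim_comp_2 (fun t => c1 * z1 t) (fun t => c2 * z2 t) Rplus
           (G := locally (c1 * z1 0)) (H := locally (c2 * z2 0))).
  + apply filterlim_comp with (1 := H1).
    apply (filterlim_scal_r (K := R_AbsRing) (V := R_NormedModule) c1).
  + apply filterlim_comp with (1 := H2).
    apply (filterlim_scal_r (K := R_AbsRing) (V := R_NormedModule) c2).
  + apply (filterlim_plus (V := R_NormedModule)).
- intros t Ht. destruct (K1 t Ht) as [D1 [C1 I1]]. destruct (K2 t Ht) as [D2 [C2 I2]].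
  split; [|split].
  + apply (is_derive_plus (fun t => c1 * z1 t) (fun t => c2 * z2 t));
      now apply is_derive_scal.
  + apply continuous_Rplus; apply continuous_Rmult; try apply continuous_const; assumption.
  + apply is_RInt_gen_ext with
      (f := fun s => plus (scal c1 (Rpower (t - s) (- g) * dz1 s)) (scal c2 (Rpower (t
        - s) (- g) * dz2 s))).
    { apply filter_forall. intros ab s _. unfold plus, scal; simpl; unfold mult; simpl. ring. }
    change (c1 * J1 t + c2 * J2 t) with (plus (scal c1 (J1 t)) (scal c2 (J2 t))).
    pose proof (is_RInt_gen_scal (fun s => Rpower (t - s) (- g) * dz1 s) c1 (J1 t) I1) as S1.
    pose proof (is_RInt_gen_scal (fun s => Rpower (t - s) (- g) * dz2 s) c2 (J2 t) I2) as S2.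
    exact (is_RInt_gen_plus _ _ _ _ S1 S2).
Qed.

(** The comparison function of [ml_neg_upper]. The integrand has the explicit primitive [P], which
    tends to 0 at [s = t], so the integral is [- P 0]. *)
Lemma has_caputo_id (T : R) :
  has_caputo T (fun t => t) (fun _ => 1) (fun t => Rpower t (1 - g) / (1 - g)).
Proof.
split; [apply continuous_at_right, continuous_id|].
intros t Ht. split; [apply (is_derive_id t)|]. split; [apply continuous_const|].
set (P := fun s => - (Rpower (t - s) (1 - g) / (1 - g))).
assert (HP : forall s, s < t -> is_derive P s (Rpower (t - s) (- g) * 1)).
{ intros s Hs. unfold P.
  assert (H2 : is_derive (fun r => Rpower r (1 - g)) (t - s) ((1 - g) * Rpower (t - s) (1 - g - 1)))
    by (apply is_derive_Rpower; lra).
  auto_derive.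
  - eexists; exact H2.
  - replace (Derive (fun r : R => Rpower r (1 - g)) (t + - s))
    with ((1 - g) * Rpower (t - s) (1 - g - 1))
      by (symmetry; apply is_derive_unique; exact H2).
    replace (1 - g - 1) with (- g) by ring. field. lra. }
apply is_RInt_gen_oo. intros eps He.
destruct (Rpower_small (1 - g) (eps / 2 * (1 - g))) as [d1 [Hd1 H1]]; [lra | nra |].
assert (HP0 : continuous P 0).
{ apply (ex_derive_continuous P). eexists. apply HP; lra. }
assert (He2 : 0 < eps / 2) by lra.
destruct (HP0 _ (locally_ball (P 0) (mkposreal _ He2))) as [d2 H2].
pose proof (cond_pos d2).
exists (Rmin (Rmin d1 d2) (t / 2)).
pose proof (Rmin_l (Rmin d1 d2) (t / 2)). pose proof (Rmin_r (Rmin d1 d2) (t / 2)).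
pose proof (Rmin_l d1 d2). pose proof (Rmin_r d1 d2).
split; [apply Rmin_pos; [apply Rmin_pos|]; lra|].
intros a b Ha Hb. exists (P b - P a). split.
- apply is_RInt_derive_on; [lra | |].
  + intros s Hs. apply HP. lra.
  + intros s Hs. apply continuous_Rmult; [|apply continuous_const].
    apply (continuous_reflect (fun r => Rpower r (- g))). apply continuous_Rpower; lra.
- assert (Hball : ball 0 d2 a).
  { apply Rabs_def1; unfold minus, plus, opp; simpl; lra. }
  specialize (H2 a Hball). change (Rabs (P a - P 0) < eps / 2) in H2. apply Rabs_def2 in H2.
  assert (Hb2 : - (eps / 2) < P b < 0).
  { specialize (H1 (t - b) ltac:(lra)). unfold P.
    assert (0 < Rpower (t - b) (1 - g) / (1 - g) < eps / 2); [|lra].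
    split; [apply Rdiv_lt_0_compat; [apply Rpower_pos | lra] | apply Rlt_div_l; lra]. }
  assert (HP00 : P 0 = - (Rpower t (1 - g) / (1 - g))) by (unfold P; now rewrite Rminus_0_r).
  change (Rabs ((P b - P a) - Rpower t (1 - g) / (1 - g)) < eps). apply Rabs_def1; lra.
Qed.

(* Integration by parts moves the derivative onto the kernel; at a maximum all the
   resulting terms have a sign. *)
Lemma caputo_at_max (T t : R) (z dz J : R -> R) :
  has_caputo T z dz J -> 0 < t < T -> (forall s, 0 <= s <= t -> z s <= z t) ->
  Rpower t (- g) * (z t - z 0) <= J t.
Proof.
intros [Hz0 Hz] Ht Hmax.
(* Subtracting the constant [z t] before integrating by parts makes the boundary term at [s = t]
   vanish: the difference is O(t - s), which beats the singularity (t - s)^(- g). *)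
set (W := fun s => Rpower (t - s) (- g) * (z s - z t)).
set (dW := fun s => Rpower (t - s) (- g) * dz s + g * Rpower (t - s) (- g - 1) * (z s - z t)).
assert (HW : forall s, 0 < s < t -> is_derive W s (dW s)).
{ intros s Hs. unfold W.
  assert (H1 : is_derive (fun r => Rpower r (- g)) (t - s) (- g * Rpower (t - s) (- g - 1)))
    by (apply is_derive_Rpower; lra).
  destruct (Hz s ltac:(lra)) as [H2 _].
  auto_derive.
  - split; [eexists; exact H1 | split; [eexists; exact H2 | exact I]].
  - replace (Derive (fun r : R => Rpower r (- g)) (t + - s)) with (- g * Rpower (t - s) (- g - 1))
      by (symmetry; apply is_derive_unique; exact H1).
    replace (Derive (fun r : R => z r) s) with (dz s)
      by (symmetry; apply is_derive_unique; exact H2).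
    unfold dW. replace (t + - s) with (t - s) by ring. ring. }
assert (Hcz : forall s, 0 < s < t -> continuous z s).
{ intros s Hs. apply (ex_derive_continuous z). eexists. apply Hz; lra. }
assert (HcW : forall s, 0 < s < t -> continuous dW s).
{ intros s Hs. apply continuous_Rplus.
  - apply continuous_Rmult; [|apply Hz; lra].
    apply (continuous_reflect (fun r => Rpower r (- g))). apply continuous_Rpower; lra.
  - apply continuous_Rmult.
    + apply continuous_Rmult; [apply continuous_const|].
      apply (continuous_reflect (fun r => Rpower r (- g - 1))). apply continuous_Rpower; lra.
    + apply (continuous_minus z (fun _ => z t)); [apply Hcz; lra | apply continuous_const]. }
apply le_epsilon. intros eps He.
destruct (Hz t Ht) as [Hd [_ HJ]].
destruct (proj1 (is_RInt_gen_oo _ _ _ _) HJ (eps / 3) ltac:(lra)) as [d1 [Hd1 H1]].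
assert (Ha : exists a, 0 < a < Rmin d1 (t / 2) /\ W a < Rpower t (- g) * (z 0 - z t) + eps / 3).
{ assert (L : filterlim W (at_right 0) (locally (Rpower t (- g) * (z 0 - z t)))).
  { apply (filterlim_comp_2 (fun s => Rpower (t - s) (- g)) (fun s => z s - z t) Rmult
           (G := locally (Rpower t (- g))) (H := locally (z 0 - z t))).
    - assert (E : filterlim (fun s => Rpower (t - s) (- g)) (at_right 0) (locally (Rpower (t
      - 0) (- g))));
        [|rewrite Rminus_0_r in E; exact E].
      apply (continuous_at_right (fun s => Rpower (t - s) (- g))).
      apply (continuous_reflect (fun r => Rpower r (- g))). apply continuous_Rpower; lra.
    - apply (filterlim_comp_2 z (fun _ =>
      - z t) Rplus (G := locally (z 0)) (H := locally (- z t)) Hz0).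
      + apply filterlim_const.
      + apply (filterlim_plus (V := R_NormedModule)).
    - apply (filterlim_mult (K := R_AbsRing)). }
  assert (He3 : 0 < eps / 3) by lra.
  assert (Hm : 0 < Rmin d1 (t / 2)) by (apply Rmin_pos; lra).
  specialize (L _ (locally_ball _ (mkposreal _ He3))).
  change (at_right 0 (fun a => Rabs (W a - Rpower t (- g) * (z 0 - z t)) < eps / 3)) in L.
  assert (N : at_right 0 (fun a => 0 < a < Rmin d1 (t / 2))).
  { exists (mkposreal _ Hm). intros y Hy Hy0.
    apply Rabs_def2 in Hy; unfold minus, plus, opp in Hy; simpl in Hy; lra. }
  destruct (filter_ex _ (filter_and _ _ L N)) as [a [HLa HNa]].
  exists a. split; [exact HNa|]. apply Rabs_def2 in HLa. lra. }
(* Differentiability at [t] gives |z (t - h) - z t| <= L h for small h, and h^(- g) L h = L h^(1 -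
   g) tends to 0. *)
assert (Hb : exists b, t - Rmin d1 (t / 2) < b < t /\ - (eps / 3) < W b).
{ apply is_derive_Reals in Hd. destruct (Hd 1 ltac:(lra)) as [d2 H2]. pose proof (cond_pos d2).
  set (L := Rabs (dz t) + 1). assert (HL : 0 < L) by (pose proof (Rabs_pos (dz t)); unfold L; lra).
  destruct (Rpower_small (1
    - g) (eps / 3 / L)) as [d3 [Hd3 H3]]; [lra | apply Rdiv_lt_0_compat; lra |].
  set (h := Rmin (Rmin d2 d3) (Rmin d1 (t / 2)) / 2).
  assert (Hh : 0 < h /\ h < d2 /\ h < d3 /\ h < Rmin d1 (t / 2)).
  { pose proof (Rmin_l (Rmin d2 d3) (Rmin d1 (t / 2))).
    pose proof (Rmin_r (Rmin d2 d3) (Rmin d1 (t / 2))).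
    pose proof (Rmin_l d2 d3). pose proof (Rmin_r d2 d3).
    assert (0 < Rmin (Rmin d2 d3) (Rmin d1 (t / 2))) by (apply Rmin_pos; apply Rmin_pos; lra).
    unfold h. lra. }
  clearbody h.
  exists (t - h). split; [lra|]. unfold W. replace (t - (t - h)) with h by ring.
  specialize (H2 (- h) ltac:(lra)). rewrite Rabs_Ropp, Rabs_pos_eq in H2 by lra.
  specialize (H2 ltac:(lra)).
  assert (H4 : Rabs (z (t - h) - z t) <= L * h).
  { replace (z (t - h) - z t) with (((z (t + - h) - z t) / - h - dz t + dz t) * - h)
      by (unfold Rminus at 4; field; lra).
    rewrite Rabs_mult, Rabs_Ropp, (Rabs_pos_eq h) by lra. apply Rmult_le_compat_r; [lra|].
    apply Rle_trans with (1 := Rabs_triang _ _). unfold L. lra. }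
  assert (H5 : Rpower h (- g) * (L * h) < eps / 3).
  { replace (Rpower h (- g) * (L * h)) with (L * Rpower h (1 - g)).
    - specialize (H3 h ltac:(lra)). apply (Rmult_lt_compat_l L) in H3; [|exact HL].
      replace (L * (eps / 3 / L)) with (eps / 3) in H3 by (field; lra). exact H3.
    - replace (1 - g) with (- g + 1) by ring. rewrite Rpower_plus, Rpower_1 by lra. ring. }
  pose proof (Rpower_pos h (- g)). apply Rabs_le_between in H4.
  assert (Rpower h (- g) * - (L * h) <= Rpower h (- g) * (z (t - h) - z t)).
  { apply Rmult_le_compat_l; lra. }
  lra. }
destruct Ha as [a [Ha Wa]]. destruct Hb as [b [Hb Wb]].
pose proof (Rmin_l d1 (t / 2)). pose proof (Rmin_r d1 (t / 2)).
destruct (H1 a b ltac:(lra) ltac:(lra)) as [y [Hy Hyn]].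
change (Rabs (y - J t) < eps / 3) in Hyn. apply Rabs_def2 in Hyn.
(* In [dW] the term containing [z s - z t] is nonpositive, because [t] is a maximum. *)
assert (HWy : W b - W a <= y).
{ apply (is_RInt_le dW (fun s => Rpower (t - s) (- g) * dz s) a b); [lra | | exact Hy |].
  - apply is_RInt_derive_on; [lra | |]; intros s Hs; [apply HW | apply HcW]; lra.
  - intros s Hs. unfold dW. pose proof (Rpower_pos (t - s) (- g - 1)).
    pose proof (Hmax s ltac:(lra)).
    assert (0 <= g * Rpower (t - s) (- g - 1) * (z t - z s)); [|lra].
    apply Rmult_le_pos; [|lra]. apply Rmult_le_pos; lra. }
lra.
Qed.

Lemma exists_max (t : R) (z : R -> R) : 0 <= t ->
  filterlim z (at_right 0) (locally (z 0)) -> (forall s, 0 < s <= t -> continuous z s) ->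
  exists m, 0 <= m <= t /\ forall s, 0 <= s <= t -> z s <= z m.
Proof.
intros Ht H0 Hc.
(* Only a limit from the right is given at 0, while the extreme value theorem asks for two-sided
   continuity; [h] continues [z] to the left by a constant. *)
set (h := fun s => if Rle_dec s 0 then z 0 else z s).
assert (Hh : forall s, 0 <= s -> h s = z s).
{ intros s Hs. unfold h. destruct (Rle_dec s 0); [|reflexivity]. f_equal. lra. }
destruct (continuity_ab_maj h 0 t Ht) as [m [Hm1 Hm2]].
- intros s Hs. apply continuity_pt_filterlim. destruct (Req_dec s 0) as [->|Hn].
  + intros P HP. rewrite Hh in HP by lra. destruct (H0 P HP) as [d Hd].
    exists d. intros r Hr. unfold h. destruct (Rle_dec r 0).
    * now apply locally_singleton.
    * apply Hd; [exact Hr | lra].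
  + apply (continuous_ext_loc _ z); [|apply Hc; lra].
    apply locally_eq_pos; [|lra]. intros r Hr. symmetry. apply Hh. lra.
- exists m. split; [exact Hm2|]. intros s Hs. specialize (Hm1 s Hs).
  rewrite !Hh in Hm1 by lra. exact Hm1.
Qed.

(** A positive value forces a positive maximum at some m > 0, where [caputo_at_max] contradicts the
    hypothesis on [J]. Comparing [J t] with the increment from [z 0], and not with 0, leaves room
    for a positive source term if [z 0] is negative; [ml_neg_dilate] exploits this. *)
Lemma caputo_max_principle (T : R) (z dz J : R -> R) :
  has_caputo T z dz J -> z 0 <= 0 ->
  (forall t, 0 < t < T -> 0 < z t -> J t < Rpower t (- g) * (z t - z 0)) ->
  forall t, 0 <= t < T -> z t <= 0.
Proof.
intros Hz H0 HJ t Ht. apply Rnot_lt_le. intros Hp.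
destruct (exists_max t z (proj1 Ht) (proj1 Hz)) as [m [Hm Hmax]].
{ intros s Hs. apply (ex_derive_continuous z). eexists. apply Hz; lra. }
assert (Hzm : 0 < z m) by (pose proof (Hmax t ltac:(lra)); lra).
assert (Hm0 : m <> 0) by (intros ->; lra).
pose proof (caputo_at_max T m z dz J Hz ltac:(lra) (fun s Hs => Hmax s ltac:(lra))).
pose proof (HJ m ltac:(lra) Hzm). lra.
Qed.

(** * Bounds for the Mittag-Leffler function on the negative axis *)

Local Notation Gam := (Gamma (1 - g)).

Lemma Gam_pos : 0 < Gam.
Proof. apply Gamma_pos; lra. Qed.

Lemma relax_nonneg (mu t : R) : 0 <= mu -> 0 <= t -> 0 <= relax mu t.
Proof.
intros Hmu Ht.
(* The horizon is [t + 1] because the maximum principle stops short of its endpoint; the summand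
   with coefficient 0 lets a single multiple pass as a linear combination. *)
pose proof (has_caputo_lin (t + 1) (-1) 0 _ _ _ _ _ _ (has_caputo_relax (t + 1) mu)
  (has_caputo_relax (t + 1) mu)) as H.
enough (-1 * relax mu t + 0 * relax mu t <= 0) by lra.
apply (caputo_max_principle _ _ _ _ H); [rewrite relax_0; lra | | lra].
intros s Hs Hp. rewrite relax_0. pose proof (Rpower_pos s (- g)). pose proof Gam_pos.
assert (0 <= Gam * mu * - relax mu s) by (apply Rmult_le_pos; nra). nra.
Qed.

Lemma relax_antitone (mu nu t : R) : 0 <= mu <= nu -> 0 <= t -> relax nu t <= relax mu t.
Proof.
intros Hmu Ht.
pose proof (has_caputo_lin (t + 1) 1 (-1) _ _ _ _ _ _ (has_caputo_relax (t + 1) nu)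
  (has_caputo_relax (t + 1) mu)) as H.
enough (1 * relax nu t + -1 * relax mu t <= 0) by lra.
apply (caputo_max_principle _ _ _ _ H); [rewrite !relax_0; lra | | lra].
intros s Hs Hp. rewrite !relax_0. pose proof (Rpower_pos s (- g)). pose proof Gam_pos.
pose proof (relax_nonneg mu s ltac:(lra) ltac:(lra)).
(* For w = relax nu - relax mu > 0, the Caputo integral is - Gam (nu w + (nu - mu) relax mu) <= 0,
   whereas w vanishes at 0. *)
assert (0 <= Gam * (nu * (relax nu s - relax mu s))) by (apply Rmult_le_pos; nra).
assert (0 <= Gam * ((nu - mu) * relax mu s)) by (apply Rmult_le_pos; nra).
nra.
Qed.

Lemma ml_neg_nonneg (x : R) : 0 <= x -> 0 <= ml (- x).
Proof. intros Hx. rewrite <- relax_1. apply relax_nonneg; lra. Qed.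

Lemma ml_neg_antitone (x y : R) : 0 <= x <= y -> ml (- y) <= ml (- x).
Proof. intros Hx. rewrite <- !relax_1. apply relax_antitone; lra. Qed.

Lemma ml_neg_le_1 (x : R) : 0 <= x -> ml (- x) <= 1.
Proof. intros Hx. rewrite <- ml_0, <- Ropp_0. apply ml_neg_antitone; lra. Qed.

Lemma relax_decreasing (mu s t : R) : 0 <= mu -> s <= t -> relax mu t <= relax mu s.
Proof.
intros Hmu Hst. apply ml_neg_antitone. pose proof (tpow_nonneg s). pose proof (tpow_le s t Hst).
nra.
Qed.

(** The negative of the decreasing function [relax x] is maximal on [0, 1] at the right end, and
    [caputo_at_max] at that point reads 1 - E_g(- x) <= Gam x E_g(- x). *)
Lemma ml_neg_lower (x : R) : 0 <= x -> 1 <= (1 + Gam * x) * ml (- x).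
Proof.
intros Hx.
pose proof (has_caputo_lin 2 (-1) 0 _ _ _ _ _ _ (has_caputo_relax 2 x) (has_caputo_relax 2 x)) as H.
pose proof (caputo_at_max 2 1 _ _ _ H ltac:(lra)) as H1. cbv beta in H1.
rewrite relax_0, relax_1 in H1.
replace (Rpower 1 (- g)) with 1 in H1 by (unfold Rpower; now rewrite ln_1, Rmult_0_r, exp_0).
specialize (H1 ltac:(intros s Hs; pose proof
  (relax_decreasing x s 1 Hx ltac:(lra)) as K; rewrite relax_1 in K; lra)).
lra.
Qed.

Lemma ml_neg_pos (x : R) : 0 <= x -> 0 < ml (- x).
Proof.
intros Hx. pose proof (ml_neg_lower x Hx). pose proof (ml_neg_nonneg x Hx).
destruct (Req_dec (ml (- x)) 0) as [E|]; [rewrite E in H; lra | lra].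
Qed.

(* Evaluate the equation where [s |-> E_g(- x s^g) + 2 s] is maximal on [0, 1]. *)
Lemma ml_neg_upper (x : R) : 0 <= x -> Gam * x * ml (- x) <= 2 / (1 - g).
Proof.
intros Hx.
pose proof (has_caputo_lin 2 1 2 _ _ _ _ _ _ (has_caputo_relax 2 x) (has_caputo_id 2)) as H.
destruct (exists_max 1 _ ltac:(lra) (proj1 H)) as [m [Hm Hmax]].
{ intros s Hs. apply continuous_Rplus; apply continuous_Rmult; try apply continuous_const.
  - apply continuous_relax.
  - apply continuous_id. }
cbv beta in Hmax.
pose proof (Hmax 1 ltac:(lra)) as H1. rewrite relax_1 in H1.
pose proof (ml_neg_nonneg x Hx).
(* At 0 the function equals 1, at 1 it is at least 2: this is the purpose of the slope 2. *)
assert (Hm0 : m <> 0).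
{ intros ->. rewrite relax_0 in H1. lra. }
pose proof (caputo_at_max 2 m _ _ _ H ltac:(lra)) as H2. cbv beta in H2.
specialize (H2 ltac:(intros s Hs; apply Hmax; lra)).
rewrite relax_0 in H2.
assert (0 <= Rpower m (- g) * (1 * relax x m + 2 * m - (1 * 1 + 2 * 0))).
{ apply Rmult_le_pos; [left; apply Rpower_pos | lra]. }
pose proof (relax_decreasing x m 1 Hx ltac:(lra)) as K. rewrite relax_1 in K.
assert (Rpower m (1 - g) / (1 - g) <= 1 / (1 - g)).
{ apply Rmult_le_compat_r; [left; apply Rinv_0_lt_compat; lra | apply Rpower_le_1; lra]. }
assert (Gam * x * ml (- x) <= Gam * x * relax x m).
{ apply Rmult_le_compat_l; [pose proof Gam_pos; nra | exact K]. }
unfold Rdiv in *. lra.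
Qed.

(** The difference w of the two sides, followed in time, starts at - K th. Its equation contains the
    positive source th Gam x E_g(- x t^g), at most th K t^(- g) by [ml_neg_upper], and this is
    exactly t^(- g) times the initial deficit. The constant is therefore the same K. *)
Lemma ml_neg_dilate (x th : R) : 0 <= x -> 0 <= th ->
  ml (- x) <= (1 + 2 / (1 - g) * th) * ml (- ((1 + th) * x)).
Proof.
intros Hx Hth. set (K := 2 / (1 - g)).
assert (HK : 0 < K) by (apply Rdiv_lt_0_compat; lra).
pose proof (has_caputo_lin 2 1 (- (1 + K * th)) _ _ _ _ _ _
  (has_caputo_relax 2 x) (has_caputo_relax 2 ((1 + th) * x))) as H.
enough (1 * relax x 1 + - (1 + K * th) * relax ((1 + th) * x) 1 <= 0).
{ rewrite !relax_1 in H0. lra. }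
apply (caputo_max_principle _ _ _ _ H); [rewrite !relax_0; nra | | lra].
intros t Ht Hp. rewrite !relax_0. pose proof Gam_pos.
set (e1 := relax x t) in *. set (e2 := relax ((1 + th) * x) t) in *.
set (w := 1 * e1 + - (1 + K * th) * e2) in *.
pose proof (Rpower_pos t (- g)) as HR.
assert (H1 : Gam * x * e1 <= K * Rpower t (- g)).
{ pose proof (tpow_nonneg t).
  pose proof (ml_neg_upper (x * tpow t) ltac:(nra)) as H2. fold K in H2.
  change (ml (- (x * tpow t))) with e1 in H2.
  replace (Gam * x * e1) with (Gam * (x * tpow t) * e1 * Rpower t (- g)).
  - apply Rmult_le_compat_r; lra.
  - rewrite tpow_pos by lra.
    assert (E : Rpower t g * Rpower t (- g) = 1)
      by (rewrite <- Rpower_plus; replace (g + - g) with 0 by ring; apply Rpower_O; lra).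
    transitivity (Gam * x * e1 * (Rpower t g * Rpower t (- g))); [ring | rewrite E; ring]. }
assert (0 <= Gam * (x * (1 + th)) * w).
{ apply Rmult_le_pos; [|lra]. apply Rmult_le_pos; nra. }
assert (th * (Gam * x * e1) <= th * (K * Rpower t (- g))) by (apply Rmult_le_compat_l; lra).
replace (1 * - (Gam * x * e1) + - (1 + K * th) * - (Gam * ((1 + th) * x) * e2))
  with (th * (Gam * x * e1) - Gam * (x * (1 + th)) * w) by (unfold w; ring).
replace (Rpower t (- g) * (w - (1 * 1 + - (1 + K * th) * 1)))
  with (Rpower t (- g) * w + th * (K * Rpower t (- g))) by ring.
assert (0 < Rpower t (- g) * w) by (apply Rmult_lt_0_compat; lra).
lra.
Qed.

Lemma has_caputo_nonpos (T mu : R) (z dz : R -> R) :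
  0 <= mu -> has_caputo T z dz (fun t => - (Gam * mu * z t)) -> z 0 <= 0 ->
  forall t, 0 <= t < T -> z t <= 0.
Proof.
intros Hmu H H0. apply (caputo_max_principle _ _ _ _ H H0).
intros t Ht Hp. pose proof Gam_pos.
assert (0 <= Gam * mu * z t) by (apply Rmult_le_pos; nra).
assert (0 < Rpower t (- g) * (z t - z 0)) by (apply Rmult_lt_0_compat; [apply Rpower_pos | lra]).
lra.
Qed.

Lemma has_caputo_ext (T : R) (z dz J J' : R -> R) :
  (forall t, J t = J' t) -> has_caputo T z dz J -> has_caputo T z dz J'.
Proof. intros E [H K]. split; [exact H|]. intros t Ht. rewrite <- E. now apply K. Qed.

(** [z - z 0 * relax mu] and its negative solve the same linear equation and vanish at 0, so both
    are nonpositive. *)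
Lemma relax_unique (T mu : R) (z dz : R -> R) :
  0 <= mu -> has_caputo T z dz (fun t => - (Gam * mu * z t)) ->
  forall t, 0 <= t < T -> z t = z 0 * relax mu t.
Proof.
intros Hmu H t Ht.
assert (Hc : forall c d, c * z 0 + d <= 0 -> c * z t + d * relax mu t <= 0).
{ intros c d Hcd.
  apply (has_caputo_nonpos T mu (fun s => c * z s + d * relax mu s)
    (fun s => c * dz s + d * drelax mu s) Hmu);
    [|rewrite relax_0; lra | exact Ht].
  eapply has_caputo_ext; [|apply (has_caputo_lin T c d _ _ _ _ _ _ H (has_caputo_relax T mu))].
  intros s. simpl. ring. }
pose proof (Hc 1 (- z 0) ltac:(lra)). pose proof (Hc (-1) (z 0) ltac:(lra)). lra.
Qed.

End FractionalExponential.

(** * Hilbert spaces *)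

Lemma Riemann_sum_linear {V W : NormedModule R_AbsRing} (l : V -> W) (f : R -> V) (ptd : SF_seq) :
  is_linear l -> l (Riemann_sum f ptd) = Riemann_sum (fun x => l (f x)) ptd.
Proof.
intros Hl. apply (SF_cons_ind (fun ptd => l (Riemann_sum f ptd)
  = Riemann_sum (fun x => l (f x)) ptd)).
- intros x0. change (l zero = zero). transitivity (l (scal 0 zero)).
  + f_equal. symmetry. apply (scal_zero_r (V := V)).
  + rewrite (linear_scal l Hl). apply (scal_zero_l (l zero)).
- intros h0 s IH. rewrite !Riemann_sum_cons, (linear_plus l Hl), (linear_scal l Hl), IH.
  reflexivity.
Qed.

Lemma is_RInt_linear {V W : NormedModule R_AbsRing} (l : V -> W) (f : R -> V) (a b : R) (I : V) :
  is_linear l -> is_RInt f a b I -> is_RInt (fun x => l (f x)) a b (l I).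
Proof.
intros Hl HI. unfold is_RInt.
apply (filterlim_ext (fun ptd => l (scal (sign (b - a)) (Riemann_sum f ptd)))).
- intros ptd. rewrite (linear_scal l Hl), (Riemann_sum_linear l f ptd Hl). reflexivity.
- apply filterlim_comp with (1 := HI). now apply linear_cont.
Qed.

(** With the coordinates as linear maps, this reduces the Caputo equation in [H] to scalar ones. *)
Lemma is_RInt_gen_linear {V W : NormedModule R_AbsRing} (l : V -> W) (f : R -> V) (a b : R)
  (I : V) :
  is_linear l -> is_RInt_gen f (at_right a) (at_left b) I ->
  is_RInt_gen (fun x => l (f x)) (at_right a) (at_left b) (l I).
Proof.
intros Hl HI P HP.
assert (HP' : locally I (fun y => P (l y))) by exact (linear_cont l I Hl P HP).
destruct (HI _ HP') as [Q R0 HQ HR HQR].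
exists Q R0; [exact HQ | exact HR |].
intros x y Hx Hy. destruct (HQR x y Hx Hy) as [z [Hz HPz]].
exists (l z). split; [now apply is_RInt_linear | exact HPz].
Qed.

Lemma is_derive_linear {V W : NormedModule R_AbsRing} (l : V -> W) (f : R -> V) (x : R) (d : V) :
  is_linear l -> is_derive f x d -> is_derive (fun t => l (f t)) x (l d).
Proof.
intros Hl Hd. unfold is_derive.
apply (filterdiff_ext_lin _ (fun y : R => l (scal y d))).
- apply (filterdiff_comp' f l x _ l Hd). now apply filterdiff_linear.
- intros y. now rewrite (linear_scal l Hl).
Qed.

Lemma is_derive_quadratic {V : NormedModule R_AbsRing} (f : R -> V) (x : R) (d : V) (C : R) :
  (forall y, Rabs (y - x) <= 1 ->
     norm (minus (minus (f y) (f x)) (scal (y - x) d)) <= C * (y - x) ^ 2) ->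
  is_derive f x d.
Proof.
intros H. split; [apply is_linear_scal_l|].
intros x0 Hx0.
(* Differentiability is stated for every limit [x0] of the filter; for [locally x] the only one is
   [x]. *)
rewrite <- (is_filter_lim_locally_unique (K := R_AbsRing)
  (V := AbsRing_NormedModule R_AbsRing) x x0 Hx0).
intros eps.
assert (HC : 0 < Rabs C + 1) by (pose proof (Rabs_pos C); lra).
assert (Hd : 0 < Rmin 1 (eps / (Rabs C + 1))).
{ apply Rmin_pos; [lra|]. apply Rdiv_lt_0_compat; [apply cond_pos | exact HC]. }
exists (mkposreal _ Hd). intros y Hy. change (Rabs (y - x) < Rmin 1 (eps / (Rabs C + 1))) in Hy.
pose proof (Rmin_l 1 (eps / (Rabs C + 1))). pose proof (Rmin_r 1 (eps / (Rabs C + 1))).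
change (norm (minus (minus (f y) (f x)) (scal (y - x) d)) <= eps * Rabs (y - x)).
apply Rle_trans with (1 := H y ltac:(lra)). rewrite <- pow2_abs. simpl.
rewrite Rmult_1_r, <- Rmult_assoc.
apply Rmult_le_compat_r; [apply Rabs_pos|].
apply Rle_trans with ((Rabs C + 1) * Rabs (y - x)).
- apply Rmult_le_compat_r; [apply Rabs_pos | pose proof (Rle_abs C); lra].
- apply Rlt_le, Rlt_le_trans
  with ((Rabs C + 1) * (eps / (Rabs C + 1))); [apply Rmult_lt_compat_l; lra|].
  right. field. lra.
Qed.

Lemma continuous_lipschitz {V : NormedModule R_AbsRing} (f : R -> V) (x C : R) :
  (forall y, Rabs (y - x) <= 1 -> norm (minus (f y) (f x)) <= C * Rabs (y - x)) ->
  continuous f x.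
Proof.
intros H. apply filterlim_locally_ball_norm. intros eps.
assert (HC : 0 < Rabs C + 1) by (pose proof (Rabs_pos C); lra).
assert (Hd : 0 < Rmin 1 (eps / (Rabs C + 1))).
{ apply Rmin_pos; [lra|]. apply Rdiv_lt_0_compat; [apply cond_pos | exact HC]. }
exists (mkposreal _ Hd). intros y Hy. change (Rabs (y - x) < Rmin 1 (eps / (Rabs C + 1))) in Hy.
pose proof (Rmin_l 1 (eps / (Rabs C + 1))). pose proof (Rmin_r 1 (eps / (Rabs C + 1))).
apply Rle_lt_trans with (1 := H y ltac:(lra)).
apply Rle_lt_trans with ((Rabs C + 1) * Rabs (y - x)).
- apply Rmult_le_compat_r; [apply Rabs_pos | pose proof (Rle_abs C); lra].
- apply Rlt_le_trans with ((Rabs C + 1) * (eps / (Rabs C + 1))); [apply Rmult_lt_compat_l; lra|].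
  right. field. lra.
Qed.

Lemma ex_series_scal_bounded (a h : nat -> R) (C : R) :
  (forall n, 0 <= a n) -> (forall n, Rabs (h n)
    <= C) -> ex_series a -> ex_series (fun n => h n * a n).
Proof.
intros Ha Hh Hs. apply (ex_series_le (fun n => h n * a n) (fun n => C * a n)).
- intros n. change (Rabs (h n * a n) <= C * a n).
  rewrite Rabs_mult, (Rabs_pos_eq (a n)) by apply Ha.
  apply Rmult_le_compat_r; [apply Ha | apply Hh].
- now apply (ex_series_scal C a).
Qed.

(* [part true] and [part false] are the real and imaginary parts. *)
Definition part (k : scalar_kind) (i : bool) : scalar k -> R :=
  match k return scalar k -> R with
  | RealScalars => fun x => if i then x else 0
  | ComplexScalars => fun z => if i then fst z else snd z
  end.

Arguments part {k} i _.

Lemma part_plus (k : scalar_kind) i (x y : scalar k) : part i (plus x y) = part i x + part i y.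
Proof. destruct k, i; simpl; try reflexivity. ring. Qed.

Lemma part_ofR_mult (k : scalar_kind) i (r : R) (x : scalar k) :
  part i (mult (ofR k r) x) = r * part i x.
Proof.
destruct k, i; simpl; unfold mult; simpl; try ring; destruct x; unfold Cmult; simpl; ring.
Qed.

Lemma part_ofR (k : scalar_kind) (r : R) : part true (ofR k r) = r.
Proof. destruct k; reflexivity. Qed.

Lemma part_zero (k : scalar_kind) i : part i (zero : scalar k) = 0.
Proof. destruct k, i; reflexivity. Qed.

Lemma part_ext (k : scalar_kind) (x y : scalar k) : (forall i, part i x = part i y) -> x = y.
Proof.
intros H. pose proof (H true) as H1. pose proof (H false) as H2.
destruct k; simpl in *; [exact H1|].
destruct x, y; simpl in *; congruence.
Qed.

Lemma abs_sqr (k : scalar_kind) (x : scalar k) : abs x ^ 2 = part true x ^ 2 + part false x ^ 2.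
Proof.
destruct k.
- change (Rabs x ^ 2 = x ^ 2 + 0 ^ 2). rewrite pow2_abs. ring.
- change (sqrt (fst x ^ 2 + snd x ^ 2) ^ 2 = fst x ^ 2 + snd x ^ 2).
  apply pow2_sqrt. pose proof (pow2_ge_0 (fst x)). pose proof (pow2_ge_0 (snd x)). lra.
Qed.

Lemma conj_mult (k : scalar_kind) (x y : scalar k) : conj (mult x y) = mult (conj x) (conj y).
Proof.
destruct k; simpl; [reflexivity|]. destruct x, y; unfold mult; simpl; unfold Cmult, Cconj; simpl.
f_equal; ring.
Qed.

Lemma conj_plus (k : scalar_kind) (x y : scalar k) : conj (plus x y) = plus (conj x) (conj y).
Proof.
destruct k; simpl; [reflexivity|]. destruct x, y; unfold plus; simpl; unfold Cplus, Cconj; simpl.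
f_equal; ring.
Qed.

Lemma conj_zero (k : scalar_kind) : conj (zero : scalar k) = zero.
Proof.
destruct k; [reflexivity|]. change ((0, - 0) = (0, 0)). now rewrite Ropp_0.
Qed.

Lemma conj_ofR (k : scalar_kind) (r : R) : conj (ofR k r) = ofR k r.
Proof. destruct k; simpl; [reflexivity|]. unfold Cconj, RtoC; simpl. f_equal; ring. Qed.

Lemma mult_conj_abs (k : scalar_kind) (x : scalar k) : part true (mult x (conj x)) = abs x ^ 2.
Proof.
rewrite abs_sqr. destruct k; simpl; [unfold mult; simpl; ring|].
destruct x; unfold mult; simpl; unfold Cmult, Cconj; simpl. ring.
Qed.

Section Hilbert.

Variables (k : scalar_kind) (H : HilbertSpace k) (phi : nat -> H).
Hypothesis Hphi : orthonormal_basis phi.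

Lemma inner_plus_r (x y z : H) : inner x (plus y z) = plus (inner x y) (inner x z).
Proof. now rewrite (inner_conj (plus y z)), inner_plus_l, conj_plus, <- !inner_conj. Qed.

Lemma inner_smul_r (a : scalar k) (x y : H) : inner x (smul a y) = mult (conj a) (inner x y).
Proof. now rewrite (inner_conj (smul a y)), inner_smul_l, conj_mult, <- inner_conj. Qed.

Lemma inner_scal_l (r : R) (x y : H) : inner (scal r x) y = mult (ofR k r) (inner x y).
Proof. now rewrite <- smul_ofR, inner_smul_l. Qed.

Lemma inner_scal_r (r : R) (x y : H) : inner x (scal r y) = mult (ofR k r) (inner x y).
Proof. now rewrite <- smul_ofR, inner_smul_r, conj_ofR. Qed.

Lemma inner_zero_l (y : H) : inner zero y = zero.
Proof.
transitivity (inner (scal 0 zero) y).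
- f_equal. symmetry. apply (scal_zero_r (V := H)).
- apply part_ext. intros i. rewrite inner_scal_l, part_ofR_mult, part_zero. apply Rmult_0_l.
Qed.

Lemma inner_sum_basis_l (a : nat -> scalar k) (n m j : nat) : (m < j)%nat ->
  inner (sum_n_m (fun i => smul (a i) (phi i)) n m) (phi j) = zero.
Proof.
destruct Hphi as [_ [Ho _]].
induction m as [|m IH]; intros Hj.
- destruct n as [|n].
  + rewrite sum_n_n, inner_smul_l, Ho by lia. apply (mult_zero_r (K := scalar k)).
  + rewrite sum_n_m_zero by lia. apply inner_zero_l.
- destruct (Compare_dec.le_lt_dec n (S m)).
  + rewrite sum_n_Sm by lia. rewrite inner_plus_l, IH, inner_smul_l, Ho by lia.
    rewrite (mult_zero_r (K := scalar k)). apply (plus_zero_l (G := scalar k)).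
  + rewrite sum_n_m_zero by lia. apply inner_zero_l.
Qed.

Lemma norm_sqr (x : H) : norm x ^ 2 = part true (inner x x).
Proof. now rewrite inner_norm, part_ofR. Qed.

Lemma norm_smul_basis (a : scalar k) (j : nat) : norm (smul a (phi j)) ^ 2 = abs a ^ 2.
Proof.
rewrite norm_sqr, inner_smul_l, inner_smul_r, (proj1 Hphi), (mult_one_r (K := scalar k)).
apply mult_conj_abs.
Qed.

Lemma norm_zero_sqr : norm (zero : H) ^ 2 = 0.
Proof. rewrite norm_sqr, inner_zero_l. apply part_zero. Qed.

Lemma pythagoras (a : nat -> scalar k) (n m : nat) :
  norm (sum_n_m (fun i => smul (a i) (phi i)) n m) ^ 2 = sum_n_m (fun i => abs (a i) ^ 2) n m.
Proof.
induction m as [|m IH].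
- destruct n as [|n].
  + rewrite !sum_n_n. apply norm_smul_basis.
  + rewrite !sum_n_m_zero by lia. apply norm_zero_sqr.
- destruct (Compare_dec.le_lt_dec n (S m)).
  + rewrite !sum_n_Sm by lia. rewrite <- IH.
    change (norm (plus (sum_n_m (fun i => smul (a i) (phi i)) n m) (smul (a (S m)) (phi (S m)))) ^ 2
      = norm (sum_n_m (fun i => smul (a i) (phi i)) n m) ^ 2 + abs (a (S m)) ^ 2).
    rewrite <- (norm_smul_basis (a (S m)) (S m)).
    set (s := sum_n_m _ n m). set (y := smul _ _).
    assert (Hsy : inner s y = zero).
    { unfold y, s. rewrite inner_smul_r, inner_sum_basis_l by lia.
      apply (mult_zero_r (K := scalar k)). }
    assert (Hys : inner y s = zero) by (now rewrite inner_conj, Hsy, conj_zero).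
    rewrite !norm_sqr, inner_plus_l, !inner_plus_r, !part_plus, Hsy, Hys, part_zero. ring.
  + rewrite !sum_n_m_zero by lia. apply norm_zero_sqr.
Qed.

(** Real-valued coordinates: they are real-linear over both fields, so the scalar theory applies to
    them directly. Over the reals the [false] coordinate is 0. *)
Definition coord (i : bool) (n : nat) (x : H) : R := part i (inner x (phi n)).

Lemma parseval (x : H) : is_series (fun n => abs (inner x (phi n)) ^ 2) (norm x ^ 2).
Proof.
destruct Hphi as [_ [_ Hs]].
apply (filterlim_ext (fun N => norm (sum_n (fun n => smul (inner x (phi n)) (phi n)) N) ^ 2)).
- intros N. apply pythagoras.
- apply (filterlim_comp _ _ _ (fun N => norm (sum_n (fun n => smul (inner x (phi n)) (phi n)) N))
  (fun r => r ^ 2)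
           _ (locally (norm x))).
  + apply filterlim_comp with (1 := Hs x). apply filterlim_norm.
  + apply (ex_derive_continuous (fun r => r ^ 2)). auto_derive. exact I.
Qed.

Lemma coord_le_norm (i : bool) (n : nat) (x : H) : Rabs (coord i n x) <= norm x.
Proof.
assert (Hsq : coord i n x ^ 2 <= norm x ^ 2).
{ apply Rle_trans with (abs (inner x (phi n)) ^ 2).
  - rewrite abs_sqr. unfold coord. pose proof (pow2_ge_0 (part true (inner x (phi n)))).
    pose proof (pow2_ge_0 (part false (inner x (phi n)))). destruct i; lra.
  - rewrite <- (is_series_unique _ _ (parseval x)).
    apply (term_le_Series (fun n => abs (inner x (phi n)) ^ 2)).
    + intros; apply pow2_ge_0.
    + eexists; apply parseval. }
rewrite <- (Rabs_pos_eq (norm x)) by apply norm_ge_0. apply Rsqr_le_abs_0. rewrite !Rsqr_pow2.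
exact Hsq.
Qed.

Lemma coord_plus (i : bool) (n : nat) (x y : H) : coord i n (plus x y) = coord i n x + coord i n y.
Proof. unfold coord. now rewrite inner_plus_l, part_plus. Qed.

Lemma coord_scal (i : bool) (n : nat) (r : R) (x : H) : coord i n (scal r x) = r * coord i n x.
Proof. unfold coord. now rewrite inner_scal_l, part_ofR_mult. Qed.

Lemma is_linear_coord (i : bool) (n : nat) : is_linear (coord i n : H -> R_NormedModule).
Proof.
split; [apply coord_plus | intros; apply coord_scal|].
exists 1. split; [lra|]. intros x. rewrite Rmult_1_l. apply coord_le_norm.
Qed.

Lemma coord_minus (i : bool) (n : nat) (x y : H) : coord i n (minus x y)
  = coord i n x - coord i n y.
Proof.
transitivity (coord i n (plus x (scal (-1) y))).
- unfold minus. do 2 f_equal. symmetry. apply (scal_opp_one (V := H)).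
- rewrite coord_plus, coord_scal. ring.
Qed.

Lemma parseval_coord (x : H) :
  is_series (fun n => coord true n x ^ 2 + coord false n x ^ 2) (norm x ^ 2).
Proof.
apply (is_series_ext (fun n => abs (inner x (phi n)) ^ 2)); [|apply parseval].
intros n. apply abs_sqr.
Qed.

(** Parseval on both sides. With [c] a common bound for the multipliers, this yields the norm
    estimates for diagonal operators below. *)
Lemma norm_le_coord (c : R) (x y : H) : 0 <= c ->
  (forall i n, Rabs (coord i n x) <= c * Rabs (coord i n y)) -> norm x <= c * norm y.
Proof.
intros Hc Hxy.
assert (Hsq : norm x ^ 2 <= (c * norm y) ^ 2).
{ rewrite Rpow_mult_distr, <- (is_series_unique _ _ (parseval_coord x)), <- (is_series_unique _ _
  (parseval_coord y)).
  rewrite <- Series_scal_l.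
  assert (Hi : forall i n, coord i n x ^ 2 <= c ^ 2 * coord i n y ^ 2).
  { intros i n.
    rewrite <- Rpow_mult_distr, <- (pow2_abs (coord i n x)), <- (pow2_abs (c * coord i n y)).
    apply pow_incr. split; [apply Rabs_pos|]. rewrite Rabs_mult, (Rabs_pos_eq c) by exact Hc.
    apply Hxy. }
  apply Series_le.
  - intros n. pose proof (Hi true n). pose proof (Hi false n).
    pose proof (pow2_ge_0 (coord true n x)). pose proof (pow2_ge_0 (coord false n x)). lra.
  - apply (ex_series_scal (c ^ 2) (fun n => coord true n y ^ 2 + coord false n y ^ 2)). eexists.
    apply parseval_coord. }
assert (Hcy : 0 <= c * norm y) by (apply Rmult_le_pos; [exact Hc | apply norm_ge_0]).
rewrite <- (Rabs_pos_eq (norm x)), <- (Rabs_pos_eq (c * norm y)) by (exact Hcy || apply norm_ge_0).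
apply Rsqr_le_abs_0. rewrite !Rsqr_pow2. exact Hsq.
Qed.

Lemma coord_ext (x y : H) : (forall i n, coord i n x = coord i n y) -> x = y.
Proof.
intros E. apply (ball_norm_eq (V := H)). intros eps.
apply Rle_lt_trans with (0 * norm x); [|rewrite Rmult_0_l; apply cond_pos].
apply norm_le_coord; [lra|]. intros i n. rewrite coord_minus, E, Rminus_diag, Rabs_R0. lra.
Qed.

(* The operator with eigenvalues [h n]; the series converges when [h] is bounded. *)
Definition diag (h : nat -> R) (v : H) : H :=
  iota (is_series (fun n => scal (h n) (smul (inner v (phi n)) (phi n)))).

Lemma inner_sum_basis (a : nat -> scalar k) (j m : nat) : (j <= m)%nat ->
  inner (sum_n (fun i => smul (a i) (phi i)) m) (phi j) = a j.
Proof.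
destruct Hphi as [Hn [Ho _]].
induction m as [|m IH]; intros Hj.
- replace j with O by lia. rewrite sum_O, inner_smul_l, Hn. apply (mult_one_r (K := scalar k)).
- rewrite sum_Sn, inner_plus_l, inner_smul_l.
  destruct (PeanoNat.Nat.eq_dec j (S m)) as [->|Hne].
  + unfold sum_n. rewrite inner_sum_basis_l, Hn by lia.
    rewrite (mult_one_r (K := scalar k)). apply (plus_zero_l (G := scalar k)).
  + rewrite IH, Ho, (mult_zero_r (K := scalar k)) by lia. apply (plus_zero_r (G := scalar k)).
Qed.

Lemma smul_series_converges (a : nat -> scalar k) :
  ex_series (fun n => abs (a n) ^ 2) -> ex_series (fun n => smul (a n) (phi n)).
Proof.
intros Ha. apply ex_series_Cauchy. intros eps.
pose proof (cond_pos eps) as He.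
assert (He2 : 0 < eps ^ 2) by (apply pow_lt; exact He).
destruct (Cauchy_ex_series _ Ha (mkposreal _ He2)) as [N HN].
exists N. intros n m Hn Hm. specialize (HN n m Hn Hm).
change (Rabs (sum_n_m (fun i => abs (a i) ^ 2) n m) < eps ^ 2) in HN.
rewrite <- pythagoras in HN.
rewrite Rabs_pos_eq in HN by apply pow2_ge_0.
apply Rnot_le_lt. intros Hle. apply (Rlt_irrefl (eps ^ 2)).
apply Rle_lt_trans with (2 := HN). apply pow_incr. split; [lra | exact Hle].
Qed.

Lemma coord_series (a : nat -> scalar k) (x : H) (i : bool) (n : nat) :
  is_series (fun n => smul (a n) (phi n)) x -> coord i n x = part i (a n).
Proof.
intros Hx.
apply (filterlim_locally_unique (F := eventually) (fun N => coord i n (sum_n (fun n => smul (a n)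
  (phi n)) N))).
- apply filterlim_comp with (1 := Hx). exact (linear_cont _ x (is_linear_coord i n)).
- apply (filterlim_ext_loc (fun _ => part i (a n))); [|apply filterlim_const].
  exists n. intros N HN. unfold coord. now rewrite inner_sum_basis.
Qed.

(** Bounded multipliers keep the coefficients square summable, so the series converges by
    completeness, and only then does [iota] return its sum. *)
Lemma coord_diag (h : nat -> R) (C : R) (v : H) (i : bool) (n : nat) :
  (forall n, Rabs (h n) <= C) -> coord i n (diag h v) = h n * coord i n v.
Proof.
intros Hh.
set (a := fun n => mult (ofR k (h n)) (inner v (phi n))).
assert (Ea : forall n, scal (h n) (smul (inner v (phi n)) (phi n)) = smul (a n) (phi n)).
{ intros m. now rewrite <- smul_ofR, smul_assoc. }
assert (Ha : ex_series (fun n => abs (a n) ^ 2)).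
{ apply (ex_series_ext (fun n => h n ^ 2 * abs (inner v (phi n)) ^ 2)).
  - intros m. change (h m ^ 2 * abs (inner v (phi m)) ^ 2 = abs (a m) ^ 2).
    rewrite !abs_sqr. unfold a. rewrite !part_ofR_mult. ring.
  - apply ex_series_scal_bounded with (C := C ^ 2).
    + intros m. apply pow2_ge_0.
    + intros m. rewrite <- RPow_abs. apply pow_incr. split; [apply Rabs_pos | apply Hh].
    + eexists. apply parseval. }
destruct (smul_series_converges a Ha) as [x Hx].
assert (E : diag h v = x).
{ unfold diag. apply iota_unique.
  - intros y Hy. apply (filterlim_locally_unique _ _ _ Hy).
    apply (is_series_ext (fun n => smul (a n) (phi n))); [intros m; now rewrite Ea | exact Hx].
  - apply (is_series_ext (fun n => smul (a n) (phi n))); [intros m; now rewrite Ea | exact Hx]. }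
rewrite E, (coord_series a x i n Hx). unfold a. rewrite part_ofR_mult. reflexivity.
Qed.

(** * Solutions *)

Section Solutions.

Variables (g T : R).
Hypotheses (Hg : 0 < g < 1) (HT : 0 < T).

(** Coordinates are continuous and linear, so they commute with the derivative and the improper
    integral; each one solves a scalar equation, and [relax_unique] applies. Asking for the
    eigenvalue relation on [dom L] alone covers [A] and [A_alpha] together. *)
Lemma solution_coord (L : operator H) (mu : R) (u : R -> H) (i : bool) (n : nat) :
  0 <= mu -> (forall x, dom L x -> coord i n (L x) = mu * coord i n x) ->
  is_solution g T L u ->
  forall t, 0 <= t <= T -> coord i n (u t) = relax g mu t * coord i n (u 0).
Proof.
intros Hmu HL [Hc [du [Hd He]]].
set (l := coord i n).
assert (Hl : is_linear (l : H -> R_NormedModule)) by apply is_linear_coord.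
pose proof (Gam_pos g Hg) as HG.
assert (Hz : has_caputo g T (fun t => l (u t)) (fun t => l (du t))
               (fun t => - (Gamma (1 - g) * mu * l (u t)))).
{ split.
  (* Continuity on [0, T] gives a limit from the right at 0, as [has_caputo] requires; the radius is
     cut to stay within [0, T]. *)
  - apply (filterlim_comp _ _ _ u l _ (locally (u 0))).
    + intros P HP. destruct (Hc 0 ltac:(lra) P HP) as [d Hd0].
      assert (Hm : 0 < Rmin d T) by (apply Rmin_pos; [apply cond_pos | exact HT]).
      exists (mkposreal _ Hm). intros y Hy Hy0.
      change (Rabs (y - 0) < Rmin d T) in Hy.
      pose proof (Rmin_l d T). pose proof (Rmin_r d T). apply Rabs_def2 in Hy.
      apply Hd0; [|lra]. change (Rabs (y - 0) < d). apply Rabs_def1; lra.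
    + exact (linear_cont l _ Hl).
  - intros t Ht. destruct (Hd t Ht) as [D1 D2]. destruct (He t Ht) as [Hdom [w [[I [HI Hw]] Hwu]]].
    split; [now apply is_derive_linear|]. split.
    + apply (continuous_comp du l); [exact D2 | exact (linear_cont l _ Hl)].
    + assert (E : l I = - (Gamma (1 - g) * mu * l (u t))).
      { apply (f_equal l) in Hwu.
        rewrite (linear_plus l Hl), Hw, (linear_scal l Hl) in Hwu.
        assert (Hlz : l zero = 0) by (unfold l, coord; rewrite inner_zero_l; apply part_zero).
        rewrite Hlz in Hwu. change (/ Gamma (1 - g) * l I + l (L (u t)) = 0) in Hwu.
        unfold l at 2 in Hwu. rewrite HL in Hwu by exact Hdom. fold (l (u t)) in Hwu.
        replace (l I) with (Gamma (1 - g) * (/ Gamma (1 - g) * l I)) by (field; lra).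
        replace (/ Gamma (1 - g) * l I) with (- (mu * l (u t))) by (unfold l in *; lra). ring. }
      rewrite <- E.
      apply (is_RInt_gen_ext (fun s => l (scal (Rpower (t - s) (- g)) (du s)))).
      { apply filter_forall. intros ab s _. apply (linear_scal l Hl). }
      now apply is_RInt_gen_linear. }
pose proof (relax_unique g Hg T mu _ _ Hmu Hz) as Hu. cbv beta in Hu.
intros t Ht. destruct (Rle_lt_or_eq_dec t T (proj2 Ht)) as [Hlt | ->].
{ rewrite (Rmult_comm (relax g mu t)). apply Hu. lra. }
(* Uniqueness stops before [T]; there, both sides are left limits of functions that agree on (0,
   T). *)
apply (filterlim_locally_unique (F := at_left T) (fun t => l (u t))).
- apply (filterlim_comp _ _ _ u l _ (locally (u T))); [|exact (linear_cont l _ Hl)].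
  intros P HP. destruct (Hc T ltac:(lra) P HP) as [d Hd0].
  assert (Hm : 0 < Rmin d T) by (apply Rmin_pos; [apply cond_pos | exact HT]).
  exists (mkposreal _ Hm). intros y Hy Hy0.
  change (Rabs (y - T) < Rmin d T) in Hy.
  pose proof (Rmin_l d T). pose proof (Rmin_r d T). apply Rabs_def2 in Hy.
  apply Hd0; [|lra]. change (Rabs (y - T) < d). apply Rabs_def1; lra.
- apply (filterlim_ext_loc (fun t => relax g mu t * l (u 0))).
  + exists (mkposreal _ HT). intros y Hy Hy0. change (Rabs (y - T) < T) in Hy.
    apply Rabs_def2 in Hy.
    rewrite Rmult_comm. symmetry. apply Hu. lra.
  + intros P HP.
    assert (Hr : continuous (fun t => relax g mu t * l (u 0)) T).
    { apply continuous_Rmult; [now apply continuous_relax | apply continuous_const]. }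
    destruct (Hr P HP) as [d Hd0]. exists d. intros y Hy _. now apply Hd0.
Qed.

Section Evolution.

(** * Construction of the solution for a bounded diagonal operator *)

Variables (mu : nat -> R) (M : R) (y : H).
Hypothesis Hmu : forall n, 0 <= mu n <= M.

(* [evol_tau tau = E_g(- tau B) y] and [devol_tau] is its derivative, where [B] is
   the bounded operator with eigenvalues [mu n]. *)
Definition evol_tau (tau : R) : H := diag (fun n => ml g (- (mu n * tau))) y.
Definition devol_tau (tau : R) : H := diag (fun n => - mu n * dml g (- (mu n * tau))) y.
Definition evol (t : R) : H := evol_tau (tpow g t).
Definition devol (t : R) : H := scal (g * Rpower t (g - 1)) (devol_tau (tpow g t)).

Lemma mu_bound (X tau : R) (n : nat) : Rabs tau <= X -> Rabs (- (mu n * tau)) <= M * X.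
Proof.
intros Ht. rewrite Rabs_Ropp, Rabs_mult. pose proof (Hmu n). rewrite (Rabs_pos_eq (mu n)) by lra.
apply Rmult_le_compat; try lra. apply Rabs_pos.
Qed.

Lemma M_nonneg : 0 <= M.
Proof. pose proof (Hmu 0). lra. Qed.

Lemma ml_bounded (X : R) : exists C, forall z, Rabs z <= X -> Rabs (ml g z) <= C.
Proof.
destruct (bounded_continuity (ml g) (- X) X) as [C HC].
{ intros z _. now apply continuous_ml. }
exists C. intros z Hz. left. apply HC. now apply Rabs_le_between.
Qed.

Lemma coord_evol_tau (tau : R) (i : bool) (n : nat) :
  coord i n (evol_tau tau) = ml g (- (mu n * tau)) * coord i n y.
Proof.
destruct (ml_bounded (M * Rabs tau)) as [C HC].
apply (coord_diag (fun n => ml g (- (mu n * tau))) C). intros m. apply HC. apply mu_bound. lra.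
Qed.

Lemma coord_devol_tau (tau : R) (i : bool) (n : nat) :
  coord i n (devol_tau tau) = - mu n * dml g (- (mu n * tau)) * coord i n y.
Proof.
destruct (dml_bounded g Hg (M * Rabs tau)) as [C [HC0 HC]].
apply (coord_diag (fun n => - mu n * dml g (- (mu n * tau))) (M * C)). intros m.
pose proof (Hmu m). rewrite Rabs_mult, Rabs_Ropp, (Rabs_pos_eq (mu m)) by lra.
apply Rmult_le_compat; [lra | apply Rabs_pos | lra | apply HC, mu_bound; lra].
Qed.

Lemma coord_evol (t : R) (i : bool) (n : nat) :
  coord i n (evol t) = relax g (mu n) t * coord i n y.
Proof. apply coord_evol_tau. Qed.

Lemma coord_devol (t : R) (i : bool) (n : nat) :
  coord i n (devol t) = drelax g (mu n) t * coord i n y.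
Proof. unfold devol, drelax. rewrite coord_scal, coord_devol_tau. ring. Qed.

Lemma near_bound (tau sigma : R) : Rabs (sigma - tau) <= 1 -> Rabs sigma <= Rabs tau + 1.
Proof.
intros Hs. replace sigma with (tau + (sigma - tau)) by ring.
apply Rle_trans with (1 := Rabs_triang _ _). lra.
Qed.

(** In the variable tau = t^g the evolution is smooth, also at 0; the singular factor t^(g - 1)
    enters through the chain rule. The Taylor remainders of the coordinates share the constant C
    M^2, so they add up to a remainder in norm. *)
Lemma is_derive_evol_tau (tau : R) : is_derive evol_tau tau (devol_tau tau).
Proof.
set (X := M * (Rabs tau + 1)).
destruct (dml_bounded g Hg X) as [C [HC0 HC]]. pose proof M_nonneg.
apply (is_derive_quadratic evol_tau tau _ (C * M ^ 2 * norm y)). intros sigma Hs.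
replace (C * M ^ 2 * norm y * (sigma - tau) ^ 2)
  with (C * M ^ 2 * (sigma - tau) ^ 2 * norm y) by ring.
apply norm_le_coord.
{ pose proof (pow2_ge_0 M). pose proof (pow2_ge_0 (sigma - tau)).
  apply Rmult_le_pos; [apply Rmult_le_pos; lra | lra]. }
intros i n. rewrite !coord_minus, coord_scal, !coord_evol_tau, coord_devol_tau.
set (c := coord i n y).
replace (ml g (- (mu n * sigma)) * c - ml g (- (mu n * tau)) * c - (sigma
  - tau) * (- mu n * dml g (- (mu n * tau)) * c))
  with ((ml g (- (mu n * sigma)) - ml g (- (mu n * tau))
    - dml g (- (mu n * tau)) * (- (mu n * sigma) - - (mu n * tau))) * c)
  by ring.
rewrite Rabs_mult. apply Rmult_le_compat_r; [apply Rabs_pos|].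
apply Rle_trans with (C * (- (mu n * sigma) - - (mu n * tau)) ^ 2).
- apply (taylor_bound (ml g) (dml g) (ddml g) X).
  + now apply is_derive_ml.
  + now apply is_derive_dml.
  + intros z Hz. now apply HC.
  + apply mu_bound. lra.
  + apply mu_bound. now apply near_bound.
- replace (- (mu n * sigma) - - (mu n * tau)) with (- mu n * (sigma - tau)) by ring.
  rewrite Rpow_mult_distr, Rmult_assoc. apply Rmult_le_compat_l; [lra|].
  apply Rmult_le_compat_r; [apply pow2_ge_0|].
  replace ((- mu n) ^ 2) with (mu n ^ 2) by ring. apply pow_incr. apply Hmu.
Qed.

Lemma continuous_devol_tau (tau : R) : continuous devol_tau tau.
Proof.
set (X := M * (Rabs tau + 1)).
destruct (dml_bounded g Hg X) as [C [HC0 HC]]. pose proof M_nonneg.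
apply (continuous_lipschitz devol_tau tau (M * (C * M) * norm y)). intros sigma Hs.
replace (M * (C * M) * norm y * Rabs (sigma - tau))
  with (M * (C * (M * Rabs (sigma - tau))) * norm y) by ring.
pose proof (Rabs_pos (sigma - tau)).
apply norm_le_coord.
{ apply Rmult_le_pos; [lra|]. apply Rmult_le_pos; [lra|]. apply Rmult_le_pos; lra. }
intros i n. rewrite coord_minus, !coord_devol_tau. set (c := coord i n y).
replace (- mu n * dml g (- (mu n * sigma)) * c - - mu n * dml g (- (mu n * tau)) * c)
  with (- mu n * (dml g (- (mu n * sigma)) - dml g (- (mu n * tau))) * c) by ring.
pose proof (Hmu n).
rewrite Rabs_mult. apply Rmult_le_compat_r; [apply Rabs_pos|].
rewrite Rabs_mult, Rabs_Ropp, (Rabs_pos_eq (mu n)) by lra.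
apply Rmult_le_compat; [lra | apply Rabs_pos | lra |].
apply Rle_trans with (C * Rabs (- (mu n * sigma) - - (mu n * tau))).
- apply (mean_value_bound (dml g) (ddml g) X).
  + now apply is_derive_dml.
  + intros z Hz. now apply HC.
  + apply mu_bound. lra.
  + apply mu_bound. now apply near_bound.
- apply Rmult_le_compat_l; [lra|].
  replace (- (mu n * sigma) - - (mu n * tau)) with (- mu n * (sigma - tau)) by ring.
  rewrite Rabs_mult, Rabs_Ropp, (Rabs_pos_eq (mu n)) by lra. apply Rmult_le_compat_r; lra.
Qed.

Lemma continuous_evol (t : R) : continuous evol t.
Proof.
apply (continuous_comp (tpow g) evol_tau); [now apply continuous_tpow|].
apply (ex_derive_continuous evol_tau). eexists. apply is_derive_evol_tau.
Qed.

Lemma is_derive_evol (t : R) : 0 < t -> is_derive evol t (devol t).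
Proof.
intros Ht. apply (is_derive_comp evol_tau (tpow g)).
- apply is_derive_evol_tau.
- now apply is_derive_tpow.
Qed.

Lemma continuous_devol (t : R) : 0 < t -> continuous devol t.
Proof.
intros Ht. apply (continuous_scal (fun t => g * Rpower t (g - 1)) (fun t => devol_tau (tpow g t))).
- apply continuous_Rmult; [apply continuous_const | now apply continuous_Rpower].
- apply (continuous_comp
  (tpow g) devol_tau); [now apply continuous_tpow | apply continuous_devol_tau].
Qed.

(** By the uniform truncation estimate each coordinate of the error is at most a small multiple of
    that of [y], the same multiple for all n; [norm_le_coord] turns this into convergence in [H]. *)
Lemma caputo_evol (t : R) : 0 < t ->
  is_RInt_gen (fun s => scal (Rpower (t - s) (- g)) (devol s)) (at_right 0) (at_left t)
    (scal (- Gamma (1 - g)) (diag mu (evol t))).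
Proof.
intros Ht. apply is_RInt_gen_oo. intros eps He.
assert (Hy : 0 <= norm y) by apply norm_ge_0.
assert (He' : 0 < eps / (norm y + 1)) by (apply Rdiv_lt_0_compat; lra).
destruct (truncated_caputo_relax g Hg M t _ Ht He') as [delta [Hd H1]].
exists (Rmin delta (t / 2)). pose proof (Rmin_l delta (t / 2)). pose proof (Rmin_r delta (t / 2)).
split; [apply Rmin_pos; lra|]. intros a b Ha Hb.
set (f := fun s => scal (Rpower (t - s) (- g)) (devol s)).
assert (HI : is_RInt f a b (RInt f a b)).
{ apply (RInt_correct f), ex_RInt_continuous_on; [lra|]. intros s Hs.
  apply (continuous_scal (fun s => Rpower (t - s) (- g)) devol).
  - apply (continuous_reflect (fun r => Rpower r (- g))). apply continuous_Rpower; lra.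
  - apply continuous_devol; lra. }
exists (RInt f a b). split; [exact HI|].
apply Rle_lt_trans with (eps / (norm y + 1) * norm y).
2:{ apply Rlt_le_trans with (eps / (norm y + 1) * (norm y + 1)); [|right; field; lra].
    apply Rmult_lt_compat_l; lra. }
apply norm_le_coord; [lra|]. intros i n.
destruct (H1 (mu n) a b) as [z [Hz Hzn]]; [pose proof
  (Hmu n); rewrite Rabs_pos_eq; lra | lra | lra |].
assert (E : coord i n (RInt f a b) = z * coord i n y).
{ transitivity (RInt (fun s => coord i n (f s)) a b).
  - symmetry. apply (is_RInt_unique (fun s => coord i n (f s))).
    exact (is_RInt_linear (coord i n : H -> R_NormedModule) f a b _ (is_linear_coord i n) HI).
  - apply (is_RInt_unique (fun s => coord i n (f s))).
    apply (is_RInt_ext (fun s => scal (coord i n y) (Rpower (t - s) (- g) * drelax g (mu n) s))).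
    + intros s _. unfold f. rewrite coord_scal, coord_devol.
      change (coord i n y * (Rpower (t - s) (- g) * drelax g (mu n) s)
              = Rpower (t - s) (- g) * (drelax g (mu n) s * coord i n y)). ring.
    + rewrite Rmult_comm. apply (is_RInt_scal (fun s => Rpower (t - s) (- g) * drelax g (mu n) s)).
      exact Hz. }
rewrite coord_minus, coord_scal, (coord_diag mu M), coord_evol, E.
2:{ intros m. pose proof (Hmu m). rewrite Rabs_pos_eq; lra. }
replace (z * coord i n y - - Gamma (1 - g) * (mu n * (relax g (mu n) t * coord i n y)))
  with ((z - - (Gamma (1 - g) * mu n * relax g (mu n) t)) * coord i n y) by ring.
rewrite Rabs_mult. apply Rmult_le_compat_r; [apply Rabs_pos | lra].
Qed.

Lemma evol_is_solution (L : operator H) :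
  (forall v, dom L v) -> (forall v, L v = diag mu v) -> is_solution g T L evol.
Proof.
intros Hdom HL. split.
- intros t _ P HP. destruct (continuous_evol t P HP) as [d Hd]. exists d. intros s Hs _.
  now apply Hd.
- exists devol. split.
  + intros t Ht. split; [apply is_derive_evol | apply continuous_devol]; lra.
  + intros t Ht. split; [apply Hdom|].
    exists (scal (/ Gamma (1 - g)) (scal (- Gamma (1 - g)) (diag mu (evol t)))).
    split.
    * eexists. split; [apply caputo_evol; lra | reflexivity].
    * apply coord_ext. intros i n. rewrite coord_plus, !coord_scal, HL.
      transitivity 0; [|symmetry; unfold coord; rewrite inner_zero_l; apply part_zero].
      pose proof (Gam_pos g Hg). field. lra.
Qed.

End Evolution.

Lemma relax_T (mu : R) : relax g mu T = ml g (- (mu * tpow g T)).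
Proof. reflexivity. Qed.

Lemma final_value_coord (L : operator H) (mu : R) (f : H) (v : R -> H) (i : bool) (n : nat) :
  0 <= mu -> (forall x, dom L x -> coord i n (L x) = mu * coord i n x) ->
  is_final_value_solution g T L f v ->
  forall t, 0 <= t <= T -> coord i n (v t) = relax g mu t * (/ relax g mu T * coord i n f).
Proof.
intros Hmu HL [Hv HvT] t Ht.
pose proof (ml_neg_pos g Hg (mu * tpow g T) (Rmult_le_pos _ _ Hmu (tpow_nonneg g T))) as Hp.
rewrite <- relax_T in Hp.
rewrite (solution_coord L mu v i n Hmu HL Hv t Ht), <- HvT.
rewrite (solution_coord L mu v i n Hmu HL Hv T) by lra. field. lra.
Qed.

(** Recovering the initial value divides by E_g(- mu T^g). For eigenvalues tending to infinity these
    inverses are unbounded, the source of ill-posedness; a bound M on the eigenvalues bounds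
    them. *)
Lemma inv_relax_bound (mu M : R) : 0 <= mu <= M ->
  0 < / relax g mu T <= / ml g (- (M * tpow g T)).
Proof.
intros Hmu. pose proof (tpow_nonneg g T) as Htp.
pose proof (ml_neg_pos g Hg (M * tpow g T) ltac:(nra)).
assert (ml g (- (M * tpow g T)) <= relax g mu T).
{ rewrite relax_T. apply (ml_neg_antitone g Hg). nra. }
split; [apply Rinv_0_lt_compat; lra | apply Rinv_le_contravar; lra].
Qed.

Lemma well_posed_diag (mu : nat -> R) (M : R) (L : operator H) :
  (forall n, 0 <= mu n <= M) -> (forall v, dom L v) -> (forall v, L v = diag mu v) ->
  well_posed g T L.
Proof.
intros Hmu Hdom HL.
assert (HLc : forall i n x, dom L x -> coord i n (L x) = mu n * coord i n x).
{ intros i n x _. rewrite HL. apply (coord_diag mu M). intros m. pose proof (Hmu m).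
  rewrite Rabs_pos_eq; lra. }
set (C := / ml g (- (M * tpow g T))).
assert (Hinv : forall n, 0 < / relax g (mu n) T <= C) by (intros n; apply inv_relax_bound, Hmu).
assert (HC : 0 < C) by (pose proof (Hinv O); lra).
split; [intros f; split|].
(* The initial value that evolves into [f] at time [T]. *)
- set (y := diag (fun n => / relax g (mu n) T) f).
  exists (evol mu y). split; [now apply (evol_is_solution mu M)|].
  apply coord_ext. intros i n. rewrite (coord_evol mu M) by exact Hmu.
  unfold y. rewrite (coord_diag _ C).
  + pose proof (Hinv n) as Hn. destruct (Req_dec (relax g (mu n) T) 0) as [E|E].
    * rewrite E, Rinv_0 in Hn. lra.
    * field. exact E.
  + intros m. pose proof (Hinv m). rewrite Rabs_pos_eq; lra.
- intros v w Hv Hw t Ht. apply coord_ext. intros i n.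
  rewrite (final_value_coord L (mu n) f v i n (proj1 (Hmu n)) (HLc i n) Hv t Ht).
  now rewrite (final_value_coord L (mu n) f w i n (proj1 (Hmu n)) (HLc i n) Hw t Ht).
- intros f eps He. exists (eps / C). split; [now apply Rdiv_lt_0_compat|].
  intros f' v w Hff Hv Hw t Ht.
  apply Rle_trans with (C * norm (minus f' f)).
  + apply norm_le_coord; [lra|]. intros i n. rewrite !coord_minus.
    rewrite (final_value_coord L (mu n) f v i n (proj1 (Hmu n)) (HLc i n) Hv t Ht).
    rewrite (final_value_coord L (mu n) f' w i n (proj1 (Hmu n)) (HLc i n) Hw t Ht).
    replace (relax g (mu n) t * (/ relax g (mu n) T * coord i n f')
      - relax g (mu n) t * (/ relax g (mu n) T * coord i n f))
      with (relax g (mu n) t * / relax g (mu n) T * (coord i n f' - coord i n f)) by ring.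
    rewrite Rabs_mult. apply Rmult_le_compat_r; [apply Rabs_pos|].
    pose proof (Hinv n). pose proof (Hmu n). pose proof (tpow_nonneg g t).
    assert (Hr : 0 <= relax g (mu n) t <= 1).
    { split; [apply (relax_nonneg g Hg); lra | apply (ml_neg_le_1 g Hg); nra]. }
    rewrite Rabs_pos_eq by nra. nra.
  + left. apply (Rmult_lt_compat_l C) in Hff; [|exact HC].
    replace (C * (eps / C)) with eps in Hff by (field; lra). exact Hff.
Qed.

Lemma norm_le_norm_pow (lambda : nat -> R) (p kappa : R) (x y : H) :
  0 <= kappa -> dom_pow phi lambda p y ->
  (forall i n, Rabs (coord i n x) <= kappa * Rpower (lambda n) p * Rabs (coord i n y)) ->
  norm x <= kappa * norm_pow phi lambda p y.
Proof.
intros Hk Hy Hxy.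
assert (Hpn : forall n, 0 <= pow_terms phi lambda p y n).
{ intros n. apply Rmult_le_pos; [left; apply Rpower_pos | apply pow2_ge_0]. }
assert (HS : 0 <= Series (pow_terms phi lambda p y)).
{ apply Rle_trans with (1 := Hpn O). now apply term_le_Series. }
assert (Hsq : norm x ^ 2 <= kappa ^ 2 * Series (pow_terms phi lambda p y)).
{ rewrite <- (is_series_unique _ _ (parseval_coord x)), <- Series_scal_l.
  apply Series_le; [|apply (ex_series_scal (kappa ^ 2) (pow_terms phi lambda p y)), Hy].
  intros n. split.
  - pose proof (pow2_ge_0 (coord true n x)). pose proof (pow2_ge_0 (coord false n x)). lra.
  - assert (Hi : forall i, coord i n x ^ 2
    <= kappa ^ 2 * Rpower (lambda n) (2 * p) * coord i n y ^ 2).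
    { intros i. replace (2 * p) with (p + p) by ring. rewrite Rpower_plus.
      replace (kappa ^ 2 * (Rpower (lambda n) p * Rpower (lambda n) p) * coord i n y ^ 2)
        with ((kappa * Rpower (lambda n) p * Rabs (coord i n y)) ^ 2)
        by (rewrite Rpow_mult_distr, pow2_abs; ring).
      rewrite <- (pow2_abs (coord i n x)). apply pow_incr. split; [apply Rabs_pos | apply Hxy]. }
    unfold pow_terms. rewrite abs_sqr. pose proof (Hi true). pose proof (Hi false).
    unfold coord in *. lra. }
unfold norm_pow.
rewrite <- (Rabs_pos_eq (norm x)) by apply norm_ge_0.
rewrite <- (Rabs_pos_eq (kappa * _)) by (apply Rmult_le_pos; [exact Hk | apply sqrt_pos]).
apply Rsqr_le_abs_0. rewrite !Rsqr_pow2, Rpow_mult_distr, pow2_sqrt by exact HS. exact Hsq.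
Qed.

(** * Error of the regularized initial value *)

Section Error.

Variables (A : operator H) (lambda : nat -> R) (b alpha : R).
Hypotheses (Hlambda : forall n, 0 < lambda n)
  (HA : forall i n x, dom A x -> coord i n (A x) = lambda n * coord i n x)
  (Hb : 1 <= b) (Halpha : 0 < alpha).

Definition theta (n : nat) : R := alpha * Rpower (lambda n) b.
Definition mu_alpha (n : nat) : R := lambda n / (1 + theta n).
Definition ratio (n : nat) : R := relax g (lambda n) T / relax g (mu_alpha n) T.

Lemma theta_pos (n : nat) : 0 < theta n.
Proof. apply Rmult_lt_0_compat; [exact Halpha | apply Rpower_pos]. Qed.

(** With y = alpha^(1/b) lambda_n the upper bound reads y <= 1 + y^b, which holds because y <= 1 or,
    as b >= 1, y <= y^b. *)
Lemma mu_alpha_bound (n : nat) : 0 <= mu_alpha n <= Rpower alpha (- (1 / b)).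
Proof.
pose proof (theta_pos n) as Hth. pose proof (Hlambda n) as Hl. unfold mu_alpha.
split; [apply Rlt_le, Rdiv_lt_0_compat; lra|].
apply Rle_div_l; [lra|].
set (beta := Rpower alpha (1 / b)).
assert (Hbeta : 0 < beta) by apply Rpower_pos.
rewrite Rpower_Ropp. fold beta.
apply (Rmult_le_reg_l beta); [exact Hbeta|]. rewrite <- Rmult_assoc, Rinv_r, Rmult_1_l by lra.
assert (E : theta n = Rpower (beta * lambda n) b).
{ rewrite <- Rpower_mult_distr by lra. unfold theta, beta. rewrite Rpower_mult.
  replace (1 / b * b) with 1 by (field; lra). now rewrite Rpower_1. }
rewrite E. set (y := beta * lambda n). assert (Hy : 0 < y) by (apply Rmult_lt_0_compat; lra).
pose proof (Rpower_pos y b). destruct (Rle_dec y 1); [lra|].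
assert (Hy1 : Rpower y 1 <= Rpower y b) by (apply Rle_Rpower; lra).
rewrite Rpower_1 in Hy1 by exact Hy. lra.
Qed.

Lemma coord_A_alpha (i : bool) (n : nat) (x : H) :
  coord i n (A_alpha phi lambda b alpha x) = mu_alpha n * coord i n x.
Proof.
apply (coord_diag mu_alpha (Rpower alpha (- (1 / b)))). intros m.
pose proof (mu_alpha_bound m). rewrite Rabs_pos_eq; lra.
Qed.

Lemma A_alpha_well_posed : well_posed g T (A_alpha phi lambda b alpha).
Proof.
apply (well_posed_diag mu_alpha (Rpower alpha (- (1 / b)))).
- apply mu_alpha_bound.
- intros v. exact I.
- reflexivity.
Qed.

Lemma relax_pos (nu : R) : 0 <= nu -> 0 < relax g nu T.
Proof. intros Hnu. apply (ml_neg_pos g Hg). apply Rmult_le_pos; [exact Hnu | apply tpow_nonneg].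
Qed.

Lemma ratio_bounds (n : nat) : 0 <= 1 - ratio n <= 1.
Proof.
pose proof (theta_pos n) as Hth. pose proof (Hlambda n) as Hl.
pose proof (proj1 (mu_alpha_bound n)) as Hm.
pose proof (relax_pos (mu_alpha n) Hm). pose proof (relax_pos (lambda n) ltac:(lra)).
assert (relax g (lambda n) T <= relax g (mu_alpha n) T).
{ apply (relax_antitone g Hg); [split; [exact Hm|] | lra]. unfold mu_alpha. apply Rle_div_l; nra. }
unfold ratio. split.
- assert (relax g (lambda n) T / relax g (mu_alpha n) T <= 1); [apply Rle_div_l; lra | lra].
- assert (0 < relax g (lambda n) T / relax g (mu_alpha n) T) by (apply Rdiv_lt_0_compat; lra). lra.
Qed.

Lemma ratio_theta (n : nat) : 1 - ratio n <= 2 / (1 - g) * theta n.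
Proof.
pose proof (theta_pos n) as Hth. pose proof (Hlambda n) as Hl.
pose proof (proj1 (mu_alpha_bound n)) as Hm.
pose proof (relax_pos (mu_alpha n) Hm) as Hp. pose proof (ratio_bounds n) as Hr.
pose proof (ml_neg_dilate g Hg (mu_alpha n * tpow g T) (theta n)
  (Rmult_le_pos _ _ Hm (tpow_nonneg g T)) ltac:(lra)) as Hd.
replace ((1 + theta n) * (mu_alpha n * tpow g T)) with (lambda n * tpow g T) in Hd
  by (unfold mu_alpha; field; lra).
rewrite <- !relax_T in Hd.
assert (E : relax g (lambda n) T = ratio n * relax g (mu_alpha n) T) by (unfold ratio; field; lra).
rewrite E in Hd. set (K := 2 / (1 - g)) in *.
assert (HK : 0 < K) by (apply Rdiv_lt_0_compat; lra).
assert (1 <= (1 + K * theta n) * ratio n).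
{ apply (Rmult_le_reg_r (relax g (mu_alpha n) T)); [exact Hp | lra]. }
(* From 1 <= (1 + K th) r one gets 1 - r <= K th r, and r <= 1. *)
assert (0 <= K * theta n * (1 - ratio n)) by (apply Rmult_le_pos; nra). lra.
Qed.

(** Interpolation between the bounds 1 and K th: since min (1, th) <= th^s for s in [0, 1], the
    constant K + 1 covers both cases. *)
Lemma ratio_power (n : nat) (s : R) : 0 <= s <= 1 ->
  1 - ratio n <= (2 / (1 - g) + 1) * (Rpower alpha s * Rpower (lambda n) (b * s)).
Proof.
intros Hs. pose proof (theta_pos n) as Hth. pose proof (ratio_theta n). pose proof (ratio_bounds n).
set (K := 2 / (1 - g)) in *. assert (HK : 0 < K) by (apply Rdiv_lt_0_compat; lra).
rewrite <- Rpower_mult, Rpower_mult_distr by (exact Halpha || apply Rpower_pos). fold (theta n).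
pose proof (Rpower_pos (theta n) s).
destruct (Rle_dec (theta n) 1).
- assert (Hle : theta n <= Rpower (theta n) s); [|nra].
  replace (theta n) with (Rpower (theta n) s * Rpower (theta n) (1 - s)) at 1.
  + pose proof (Rpower_le_1 (theta n) (1 - s) ltac:(lra) ltac:(lra)). nra.
  + rewrite <- Rpower_plus. replace (s + (1 - s)) with 1 by ring. now apply Rpower_1.
- assert (1 <= Rpower (theta n) s); [|nra].
  rewrite <- (Rpower_O (theta n)) at 1 by lra. apply Rle_Rpower; lra.
Qed.

(** [x1] is the bias of the regularization, [x2] the data error carried back to time 0. The factor
    [kappa] is left open so that p < b and p >= b can be treated alike. *)
Lemma backward_error (p kappa eps E : R) (f : H) (u v : R -> H) :
  0 <= kappa ->
  (forall n, 1 - ratio n <= kappa * Rpower (lambda n) p) ->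
  backward_solution g T A phi lambda p eps E f u ->
  is_final_value_solution g T (A_alpha phi lambda b alpha) f v ->
  norm (minus (u 0) (v 0))
    <= kappa * E + (1 + Gamma (1 - g) * tpow g T * Rpower alpha (- (1 / b))) * eps.
Proof.
intros Hk Hr [Hu [HuT [Hdom HE]]] Hv.
set (C := 1 + Gamma (1 - g) * tpow g T * Rpower alpha (- (1 / b))).
assert (Hinv : forall n, 0 < / relax g (mu_alpha n) T <= C).
{ intros n. pose proof (mu_alpha_bound n) as Hm. pose proof (relax_pos _ (proj1 Hm)) as Hp.
  split; [now apply Rinv_0_lt_compat|].
  pose proof (tpow_nonneg g T). pose proof (Gam_pos g Hg).
  pose proof (ml_neg_lower g Hg (mu_alpha n * tpow g T) ltac:(nra)) as Hlow.
  rewrite <- relax_T in Hlow.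
  assert (Gamma (1 - g) * (mu_alpha n * tpow g T)
    <= Gamma (1 - g) * tpow g T * Rpower alpha (- (1 / b))).
  { rewrite (Rmult_assoc (Gamma (1 - g)) (tpow g T)), (Rmult_comm (tpow g T)).
    apply Rmult_le_compat_l; [lra|]. apply Rmult_le_compat_r; lra. }
  apply (Rmult_le_reg_r (relax g (mu_alpha n) T)); [exact Hp|]. rewrite Rinv_l by lra.
  apply Rle_trans with (1 := Hlow). apply Rmult_le_compat_r; [lra|]. unfold C. lra. }
set (x1 := diag (fun n => 1 - ratio n) (u 0)).
set (x2 := diag (fun n => / relax g (mu_alpha n) T) (minus (u T) f)).
assert (C1 : forall i n, coord i n x1 = (1 - ratio n) * coord i n (u 0)).
{ intros i n. apply (coord_diag (fun n => 1 - ratio n) 1). intros m. pose proof (ratio_bounds m).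
  rewrite Rabs_pos_eq; lra. }
assert (C2 : forall i n, coord i n x2 = / relax g (mu_alpha n) T * coord i n (minus (u T) f)).
{ intros i n. apply (coord_diag (fun n => / relax g (mu_alpha n) T) C). intros m.
  pose proof (Hinv m). rewrite Rabs_pos_eq; lra. }
assert (Ex : minus (u 0) (v 0) = plus x1 x2).
{ apply coord_ext. intros i n. rewrite coord_plus, C1, C2, !coord_minus.
  pose proof (proj1 (mu_alpha_bound n)) as Hm. pose proof (relax_pos _ Hm).
  rewrite (solution_coord A (lambda n) u i n (Rlt_le _ _ (Hlambda n)) (HA i n) Hu T) by lra.
  rewrite (final_value_coord _ (mu_alpha n) f v i n Hm
    (fun x _ => coord_A_alpha i n x) Hv 0) by lra.
  rewrite relax_0. unfold ratio. field. lra. }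
rewrite Ex. apply Rle_trans with (1 := norm_triangle x1 x2). apply Rplus_le_compat.
- apply Rle_trans with (kappa * norm_pow phi lambda p (u 0)); [|now apply Rmult_le_compat_l].
  apply norm_le_norm_pow; [exact Hk | exact Hdom |]. intros i n.
  rewrite C1, Rabs_mult. apply Rmult_le_compat_r; [apply Rabs_pos|].
  pose proof (ratio_bounds n). rewrite Rabs_pos_eq by lra. apply Hr.
- pose proof (Hinv O).
  apply Rle_trans with (C * norm (minus (u T) f)); [|apply Rmult_le_compat_l; lra].
  apply norm_le_coord; [lra|]. intros i n. rewrite C2, Rabs_mult.
  apply Rmult_le_compat_r; [apply Rabs_pos|]. pose proof (Hinv n). rewrite Rabs_pos_eq; lra.
Qed.

End Error.

End Solutions.

(** Self-adjointness moves [A] onto the eigenvector: (A x, phi_n) = (x, lambda_n phi_n), so the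
    expansion of [x] need not be differentiated termwise by [A]. *)
Lemma admissible_coord (A : operator H) (lambda : nat -> R) :
  admissible A phi lambda ->
  (forall n, lambda O <= lambda n) /\ (forall n, 0 < lambda n) /\
  forall i n x, dom A x -> coord i n (A x) = lambda n * coord i n x.
Proof.
intros (_ & [_ Hsa] & _ & _ & _ & Heig & H0 & Hinc & _).
assert (Hle : forall n, lambda O <= lambda n).
{ induction n as [|n IH]; [lra | pose proof (Hinc n); lra]. }
split; [exact Hle|]. split; [intros n; pose proof (Hle n); lra|].
intros i n x Hx. unfold coord.
rewrite (proj1 (Hsa (phi n) (scal (lambda n) (phi n))) (Heig n) x Hx).
rewrite inner_scal_r. apply part_ofR_mult.
Qed.

End Hilbert.

(** Here q is p or b. For this exponent both main terms are multiples of eps^(q/(q+1)) E^(1/(q+1)),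
    and the isolated [eps] is absorbed because eps / E < 1. *)
Lemma convergence_rate (q c G eps E : R) : 0 < q -> 0 <= G -> 0 < eps < E ->
  c * Rpower (eps / E) (q / (q + 1)) * E + (1 + G * Rpower (eps / E) (- (1 / (q + 1)))) * eps
  <= (c + 1 + G) * Rpower eps (q / (q + 1)) * Rpower E (1 / (q + 1)).
Proof.
intros Hq HG He. set (s := 1 / (q + 1)).
assert (Hs : 0 < s) by (apply Rdiv_lt_0_compat; lra).
replace (q / (q + 1)) with (1 - s) by (unfold s; field; lra).
assert (HiE : 0 < / E) by (apply Rinv_0_lt_compat; lra).
assert (Hquot : forall x, Rpower (eps / E) x = Rpower eps x * Rpower E (- x)).
{ intros x. unfold Rdiv. rewrite <- Rpower_mult_distr by lra. f_equal.
  unfold Rpower. rewrite ln_Rinv by lra. f_equal. ring. }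
assert (H1 : Rpower (eps / E) (1 - s) * E = Rpower eps (1 - s) * Rpower E s).
{ rewrite Hquot, Rmult_assoc. f_equal. rewrite <- (Rpower_1 E) at 2 by lra.
  rewrite <- Rpower_plus. f_equal. ring. }
assert (H2 : Rpower (eps / E) (- s) * eps = Rpower eps (1 - s) * Rpower E s).
{ rewrite Hquot, Ropp_involutive. rewrite <- (Rpower_1 eps) at 2 by lra.
  rewrite (Rmult_comm (Rpower eps (- s))), Rmult_assoc, <- Rpower_plus, Rmult_comm. do 2 f_equal.
  ring. }
assert (H3 : eps <= Rpower (eps / E) (- s) * eps).
{ rewrite <- (Rmult_1_l eps) at 1. apply Rmult_le_compat_r; [lra|].
  rewrite Rpower_Ropp, <- Rinv_1. apply Rinv_le_contravar; [apply Rpower_pos|].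
  apply Rpower_le_1; [|lra]. split; [apply Rdiv_lt_0_compat; lra | apply Rle_div_l; lra]. }
rewrite H2 in H3. set (Q := Rpower eps (1 - s) * Rpower E s) in *.
replace (c * Rpower (eps / E) (1 - s) * E + (1 + G * Rpower (eps / E) (- s)) * eps)
  with (c * (Rpower (eps / E) (1 - s) * E) + eps + G * (Rpower (eps / E) (- s) * eps)) by ring.
rewrite H1, H2, (Rmult_assoc (c + 1 + G)). fold Q. lra.
Qed.

Theorem theorem2 (gamma T b : R)
  (hgamma : 0 < gamma < 1) (hT : 0 < T) (hb : 1 <= b) :
  (forall (k : scalar_kind) (H : HilbertSpace k) (A : operator H)
      (phi : nat -> H) (lambda : nat -> R),
    admissible A phi lambda ->
    forall alpha : R, 0 < alpha ->
      well_posed gamma T (A_alpha phi lambda b alpha))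
  /\
  (forall lambda1 p : R, 0 < lambda1 -> 0 < p ->
    (p < b ->
      exists C1 : R,
        forall (k : scalar_kind) (H : HilbertSpace k) (A : operator H)
          (phi : nat -> H) (lambda : nat -> R),
        admissible A phi lambda -> lambda O = lambda1 ->
        forall (eps E : R) (f : H) (u v : R -> H),
        0 < eps < E ->
        backward_solution gamma T A phi lambda p eps E f u ->
        is_final_value_solution gamma T
          (A_alpha phi lambda b (Rpower (eps / E) (b / (p + 1)))) f v ->
        norm (minus (u 0) (v 0))
          <= C1 * Rpower eps (p / (p + 1)) * Rpower E (1 / (p + 1)))
    /\
    (b <= p ->
      exists C2 : R,
        forall (k : scalar_kind) (H : HilbertSpace k) (A : operator H)
          (phi : nat -> H) (lambda : nat -> R),
        admissible A phi lambda -> lambda O = lambda1 ->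
        forall (eps E : R) (f : H) (u v : R -> H),
        0 < eps < E ->
        backward_solution gamma T A phi lambda p eps E f u ->
        is_final_value_solution gamma T
          (A_alpha phi lambda b (Rpower (eps / E) (b / (b + 1)))) f v ->
        norm (minus (u 0) (v 0))
          <= C2 * Rpower eps (b / (b + 1)) * Rpower E (1 / (b + 1)))).
Proof.
pose proof (Gam_pos gamma hgamma) as HG. pose proof (tpow_nonneg gamma T) as Htp.
assert (HGT : 0 <= Gamma (1 - gamma) * tpow gamma T) by (apply Rmult_le_pos; lra).
assert (HK : 0 < 2 / (1 - gamma)) by (apply Rdiv_lt_0_compat; lra).
split; [|intros lambda1 p Hl1 Hp; split; intros Hpb].
- intros k H A phi lambda HA alpha Halpha.
  assert (Hphi : orthonormal_basis phi) by apply HA.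
  destruct (admissible_coord k H phi A lambda HA) as [_ [Hl _]].
  now apply A_alpha_well_posed.
(* The first two terms are the constant K + 1 of [ratio_power]; the rest is 1 + G from
   [convergence_rate] with G = Gamma (1 - gamma) T^gamma. *)
- exists (2 / (1 - gamma) + 1 + 1 + Gamma (1 - gamma) * tpow gamma T).
  intros k H A phi lambda HA Hl0 eps E f u v He Hu Hv.
  assert (Hphi : orthonormal_basis phi) by apply HA.
  destruct (admissible_coord k H phi A lambda HA) as [_ [Hl Hc]].
  set (alpha := Rpower (eps / E) (b / (p + 1))) in *.
  assert (Halpha : 0 < alpha) by apply Rpower_pos.
  assert (E1 : Rpower alpha (p / b) = Rpower (eps / E) (p / (p + 1))).
  { unfold alpha. rewrite Rpower_mult. f_equal. field. lra. }
  assert (E2 : Rpower alpha (- (1 / b)) = Rpower (eps / E) (- (1 / (p + 1)))).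
  { unfold alpha. rewrite Rpower_mult. f_equal. field. lra. }
  refine (Rle_trans _ _ _ _ (convergence_rate p (2 / (1 - gamma) + 1) (Gamma (1
    - gamma) * tpow gamma T) eps E Hp HGT He)).
  rewrite <- E1, <- E2.
  apply (backward_error k H phi Hphi gamma T hgamma hT A lambda b alpha Hl Hc hb Halpha p _ eps E f
    u v); auto.
  + apply Rmult_le_pos; [lra | left; apply Rpower_pos].
  (* The exponent s = p / b turns lambda_n^(b s) into the weight lambda_n^p of the source condition;
     s <= 1 because p < b. *)
  + intros n. rewrite Rmult_assoc.
    replace (Rpower (lambda n) p) with (Rpower (lambda n) (b * (p / b))) by (f_equal; field; lra).
    apply ratio_power; auto. split; [left; apply Rdiv_lt_0_compat; lra | apply Rle_div_l; lra].
- exists ((2 / (1 - gamma) + 1) * Rpower lambda1 (b - p) + 1 + Gamma (1 - gamma) * tpow gamma T).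
  intros k H A phi lambda HA Hl0 eps E f u v He Hu Hv.
  assert (Hphi : orthonormal_basis phi) by apply HA.
  destruct (admissible_coord k H phi A lambda HA) as [Hmin [Hl Hc]].
  set (alpha := Rpower (eps / E) (b / (b + 1))) in *.
  assert (Halpha : 0 < alpha) by apply Rpower_pos.
  assert (E2 : Rpower alpha (- (1 / b)) = Rpower (eps / E) (- (1 / (b + 1)))).
  { unfold alpha. rewrite Rpower_mult. f_equal. field. lra. }
  refine (Rle_trans _ _ _ _ (convergence_rate b ((2 / (1 - gamma) + 1) * Rpower lambda1 (b
    - p)) (Gamma (1 - gamma) * tpow gamma T) eps E ltac:(lra) HGT He)).
  rewrite <- E2. fold alpha.
  pose proof (Rpower_pos lambda1 (b - p)) as Hlp.
  apply (backward_error k H phi Hphi gamma T hgamma hT A lambda b alpha Hl Hc hb Halpha p _ eps E f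
    u v); auto.
  + apply Rmult_le_pos; [apply Rmult_le_pos; lra | lra].
  + intros n.
    (* For p >= b the interpolation is used at its endpoint s = 1. *)
    apply Rle_trans with
      (1 := ratio_power gamma T hgamma hT lambda b alpha Hl hb Halpha n 1 ltac:(lra)).
    rewrite Rpower_1, Rmult_1_r by exact Halpha.
    replace (Rpower (lambda n) b) with (Rpower (lambda n) (b - p) * Rpower (lambda n) p)
      by (rewrite <- Rpower_plus; f_equal; ring).
    (* As b - p <= 0, the smallest eigenvalue is the worst case. *)
    assert (Hle : Rpower (lambda n) (b - p) <= Rpower lambda1 (b - p)).
    { apply Rpower_le_base_neg; [pose proof (Hmin n); lra | lra]. }
    replace ((2 / (1 - gamma) + 1) * Rpower lambda1 (b - p) * alpha * Rpower (lambda n) p)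
      with ((2 / (1 - gamma) + 1) * (alpha * (Rpower lambda1 (b
        - p) * Rpower (lambda n) p))) by ring.
    pose proof (Rpower_pos (lambda n) p).
    apply Rmult_le_compat_l; [lra|]. apply Rmult_le_compat_l; [lra|]. apply Rmult_le_compat_r; lra.
Qed.
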